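(* Let $\Omega$ be a compact metric space and let $K$ be a kernel on $\Omega\times\Omega$. Suppose that there exists a measure $\mu\in\mathbb P(\Omega)$ which is $K$-invariant, i.e. $U_K^\mu(x)=I_K(\mu)$ for all $x\in\Omega$, and has full support, i.e. $\operatorname{supp}(\mu)=\Omega$. Then the following conditions are equivalent: (1) $K$ is positive definite. (2) $I_K(\mu_1)\ge0$ and $I_K(\mu_1,\mu_2)\le\sqrt{I_K(\mu_1)I_K(\mu_2)}$ hold for all $\mu_1,\mu_2\in\mathbb P(\Omega)$. (3) $\mu$ is a global minimizer of $I_K$ over $\mathbb P(\Omega)$ and satisfies $I_K(\mu)\ge0$. (4) $I_K$ is convex on $\mathcal M(\Omega)$. (5) $K$ can be represented as $$K(x,y)=\sum_{j=1}^{\dim(L^2(\Omega,\mu))}\lambda_j\phi_j(x)\phi_j(y)$$ for some functions $\phi_j:\Omega\to\mathbb R$ and real numbers $\lambda_j$, where the series converges uniformly and absolutely, and $\lambda_j\ge0$ for $j\ge1$. (6) There exists some symmetric $k\in L^2(\Omega\times\Omega,\mu\times\mu)$ such that for all $x,y\in\Omega$, $$K(x,y)=\int_\Omega k(x,z)k(z,y)\,d\mu(z).$$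
   Context: A kernel on $\Omega\times\Omega$ is a continuous symmetric function $K:\Omega\times\Omega\to\mathbb R$. $\mathcal M(\Omega)$ is the set of finite regular signed Borel measures on $\Omega$; $\mathbb P(\Omega)$ the Borel probability measures. For $\mu,\nu\in\mathcal M(\Omega)$: $I_K(\mu,\nu)=\int_\Omega\int_\Omega K(x,y)\,d\mu(x)\,d\nu(y)$, $I_K(\mu)=I_K(\mu,\mu)$, and $U_K^\mu(x)=\int_\Omega K(x,y)\,d\mu(y)$. $K$ is positive definite if $I_K(\nu)\ge0$ for every $\nu\in\mathcal M(\Omega)$. $I_K$ is convex on $\mathcal M(\Omega)$ if $I_K((1-t)\mu+t\nu)\le(1-t)I_K(\mu)+tI_K(\nu)$ for all $\mu,\nu\in\mathcal M(\Omega)$ and $t\in[0,1]$. $\dim(L^2(\Omega,\mu))$ may be infinite, in which case the sum is an infinite series over $j\ge1$. In (6), $k$ is understood as an everywhere-defined real-valued measurable function with $k(x,y)=k(y,x)$, square-integrable with respect to $\mu\times\mu$, for which the displayed integral exists for every $x,y\in\Omega$. *)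

(* Defs.v *)
From HB Require Import structures.
From mathcomp Require Import all_boot all_order all_algebra.
From mathcomp Require Import all_classical all_reals all_analysis.

Set Implicit Arguments.
Unset Strict Implicit.
Unset Printing Implicit Defensive.

Import Order.TTheory GRing.Theory Num.Theory.
Import numFieldNormedType.Exports.

Local Open Scope classical_set_scope.
Local Open Scope ring_scope.

(* A measurableType must be pointed, so the Borel structure needs a base point.
   This excludes only the empty space, which carries no probability measure. *)
#[short(type="pmetricType")]
HB.structure Definition PMetric (K : numDomainType) :=
  { M of Pointed M & Metric K M }.

Notation borel T := (g_sigma_algebraType (@open T)).

Section charge_integral.
Context {d : measure_display} {T : measurableType d} {R : realType}.
Implicit Types nu : {charge set T -> \bar R}.

Lemma hahn_ex nu : {PN : set T * set T | hahn_decomposition nu PN.1 PN.2}.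
Proof.
by have [P /cid[N h]] := cid (Hahn_decomposition nu); exists (P, N).
Qed.

(* The Jordan decomposition does not depend on the Hahn decomposition chosen. *)
Definition pos_part nu : {finite_measure set T -> \bar R} :=
  jordan_pos (svalP (hahn_ex nu)).

Definition neg_part nu : {finite_measure set T -> \bar R} :=
  jordan_neg (svalP (hahn_ex nu)).

Definition total_variation nu : {measure set T -> \bar R} :=
  charge_variation (svalP (hahn_ex nu)).

Definition charge_integral nu (f : T -> R) : R :=
  \int[pos_part nu]_x f x - \int[neg_part nu]_x f x.

Definition charge_of_probability (P : probability T R) :
  {charge set T -> \bar R} := charge_of_finite_measure P.

End charge_integral.

Section borel_measures.
Context {R : realType} {Omega : pmetricType R}.

Definition regular_charge (nu : {charge set (borel Omega) -> \bar R}) : Prop :=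
  forall A : set (borel Omega), measurable A ->
    total_variation nu A =
      ereal_inf [set total_variation nu U | U in
                  [set U : set Omega | open U /\ A `<=` U]] /\
    total_variation nu A =
      ereal_sup [set total_variation nu F | F in
                  [set F : set Omega | compact F /\ F `<=` A]].

Definition measure_support (mu : {measure set (borel Omega) -> \bar R}) : set Omega :=
  [set x | forall U : set Omega, open U -> U x -> (0 < mu U)%E].

End borel_measures.

Section kernels.
Context {R : realType} {Omega : pmetricType R}.
Implicit Types (K : Omega * Omega -> R).
Implicit Types (mu nu : {charge set (borel Omega) -> \bar R}).

Definition kernel_function K : Prop :=
  continuous K /\ forall x y, K (x, y) = K (y, x).

Definition mutual_energy K mu nu : R :=
  charge_integral nu (fun y => charge_integral mu (fun x => K (x, y))).

Definition energy K mu : R := mutual_energy K mu mu.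

Definition potential K mu (x : Omega) : R :=
  charge_integral mu (fun y => K (x, y)).

Definition invariant_measure K mu : Prop :=
  forall x, potential K mu x = energy K mu.

Definition positive_definite K : Prop :=
  forall nu, regular_charge nu -> 0 <= energy K nu.

Definition energy_convex K : Prop :=
  forall mu nu, regular_charge mu -> regular_charge nu ->
  forall t : R, 0 <= t <= 1 ->
    energy K (cadd (cscale (1 - t) mu) (cscale t nu)) <=
      (1 - t) * energy K mu + t * energy K nu.

End kernels.

Section L2.
Context {d : measure_display} {T : measurableType d} {R : realType}.
Variable mu : {measure set T -> \bar R}.

(* linear independence of the classes modulo mu-a.e. equality *)
Definition ae_free n (f : 'I_n -> T -> R) : Prop :=
  forall c : 'I_n -> R,
    {ae mu, forall x, \sum_(i < n) c i * f i x = 0} -> forall i, c i = 0.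

(* All infinite dimensions are identified with +oo. *)
Definition L2_dim : \bar R :=
  ereal_sup [set (n%:R)%:E | n in
    [set n : nat | exists f : 'I_n -> T -> R,
                     (forall i, f i \in Lfun mu 2%:E) /\ ae_free f]].

End L2.

Section expansions.
Context {R : realType} {Omega : pmetricType R}.
Variables (mu : probability (borel Omega) R) (K : Omega * Omega -> R).

(* Indices start at 0, so that j ranges over the naturals j < dim L^2(mu). *)
Definition mercer_expansion : Prop :=
  exists (lambda : nat -> R) (phi : nat -> Omega -> R),
  [/\ forall j, ((j%:R)%:E < L2_dim mu)%E -> 0 <= lambda j,
      {uniform, (fun (n : nat) (p : Omega * Omega) =>
         \sum_(0 <= j < n | ((j%:R)%:E < L2_dim mu)%E)
           lambda j * phi j p.1 * phi j p.2) @ \oo --> K} &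
      forall x y, cvgn (fun n : nat =>
         \sum_(0 <= j < n | ((j%:R)%:E < L2_dim mu)%E)
           `|lambda j * phi j x * phi j y|)].

Definition symmetric_L2_factorization : Prop :=
  exists k : borel Omega * borel Omega -> R,
  [/\ k \in Lfun (mu \x mu)%E 2%:E,
      forall x y, k (x, y) = k (y, x),
      forall x y, mu.-integrable setT (fun z => (k (x, z) * k (z, y))%:E) &
      forall x y, K (x, y) = \int[mu]_z (k (x, z) * k (z, y))].

End expansions.

(* Main.v *)
Require Import Defs.
From HB Require Import structures.
From mathcomp Require Import all_boot all_order all_algebra.
From mathcomp Require Import finmap.
From mathcomp Require Import all_classical all_reals all_analysis.
From mathcomp Require Import measurable_realfun.
From mathcomp Require Import ring lra.
Import Order.TTheory GRing.Theory Num.Theory.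
Import numFieldNormedType.Exports.
Local Open Scope classical_set_scope.
Local Open Scope ring_scope.
Set Implicit Arguments.
Unset Strict Implicit.
Unset Printing Implicit Defensive.

(** Each of the six conditions is equivalent to positive semidefiniteness of
    the kernel on finite weighted sets of points, i.e. to the inequality
    [0 <= \sum_(a, b) a.1 * b.1 * K (a.2, b.2)] for every finite list of
    weighted points (predicate [psd]); the proof goes through [psd] each time.

    Measures and points.  By compactness [K] is uniformly continuous, so on a
    partition of the space into small pieces the energy of any functional that
    is linear and bounded on bounded measurable functions is close to a finite
    double sum over points of the pieces ([bienergy_approx]).  This shows at
    once that energies are symmetric, depend only on the values of the charge on
    sets, and are nonnegative when the kernel is [psd]; Cauchy-Schwarz and
    convexity are then the usual computations with a nonnegative quadratic
    form.  Conversely finite combinations of Dirac masses are regular charges,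
    which gives back [psd] from positive definiteness and from convexity.

    Minimality.  Since the potential of [mu] is constant, moving from [mu] in the
    direction of a density of mean zero changes the energy by the quadratic
    term only.  So minimality makes the energy nonnegative on all bounded
    densities ([minimizer_density]), and as every ball has positive measure,
    averages over small balls concentrate these densities at arbitrary points
    ([psd_of_density]).

    Expansion.  A [psd] kernel is expanded by the pivoted Cholesky algorithm:
    subtract from the kernel its component along the point where its diagonal
    is largest, and repeat.  Pivots at which the residual diagonal exceeds
    [e] are separated by a distance depending only on [e] and [K], so by
    compactness the residuals tend to zero uniformly ([pivot_cvg0]); and [n.+1] nonzero terms
    produce [n.+1] separated points, hence [n.+1] disjoint balls of positive
    measure and [n.+1] independent elements of L2, so that the number of terms
    never exceeds the dimension ([pivot_dim]).

    Square root.  A symmetric [k] with [K (x, y) = \int k (x, z) * k (z, y)] is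
    the kernel of a square root of the integral operator [T] of [K].  After
    scaling so that [T] is a contraction, the polynomials [y_0 = 0],
    [y_(n+1) = y_n + (X - y_n ^+ 2) / 2] increase to the square root on [0, 1],
    and every inequality used about them has a certificate as a sum of terms
    [q ^+ 2], [X * q ^+ 2], [(1 - X) * q ^+ 2] (predicate [cone]), which become
    nonnegative operators when [X] is replaced by [T].  As all the [y_n] are
    multiples of [X], the [y_n (T)] have continuous kernels.  The residual
    kernels of [T - y_n (T) ^+ 2] are [psd], are dominated by [K] and tend weakly
    to zero, hence tend to zero uniformly by equicontinuity
    ([residual_kernel_cvg0]); this makes the kernels of [y_n (T)] converge in L2
    in each row at a uniform rate, and along a subsequence almost everywhere in
    each row, to the required [k] ([limit_kernel_factor]). *)

(** * Bounded linear functionals on bounded measurable functions *)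

Section bounded_functionals.
Context {d : measure_display} {T : measurableType d} {R : realType}.
Implicit Types (f g : T -> R) (L : (T -> R) -> R) (C : R).

Definition bmeas f := measurable_fun setT f /\ exists M, forall x, `|f x| <= M.

(** Integrals against finite measures, charges and bounded densities, and
    evaluations at points, all have this form, and the arguments below only use
    linearity and the bound [C]. *)
Record bfunctional L C : Prop := BFunctional {
  bf_ge0 : 0 <= C;
  bf_lin : forall a f g, bmeas f -> bmeas g ->
    L (fun x => a * f x + g x) = a * L f + L g;
  bf_le : forall f M, bmeas f -> (forall x, `|f x| <= M) -> `|L f| <= C * M }.

Lemma bmeas_cst c : bmeas (fun _ => c).
Proof. by split=> //; exists `|c|. Qed.

Lemma bmeas_lin a f g : bmeas f -> bmeas g -> bmeas (fun x => a * f x + g x).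
Proof.
move=> [mf [M fM]] [mg [N gN]]; split.
  by apply: measurable_funD => //; apply: measurable_funM => //.
exists (`|a| * M + N) => x; rewrite (le_trans (ler_normD _ _))// lerD//.
by rewrite normrM ler_wpM2l.
Qed.

Lemma bmeasZ a f : bmeas f -> bmeas (fun x => a * f x).
Proof.
move=> bf; have := bmeas_lin a bf (bmeas_cst 0).
by under eq_fun do rewrite addr0.
Qed.

Lemma bmeasD f g : bmeas f -> bmeas g -> bmeas (fun x => f x + g x).
Proof.
move=> bf bg; have := bmeas_lin 1 bf bg.
by under eq_fun do rewrite mul1r.
Qed.

Lemma bmeasB f g : bmeas f -> bmeas g -> bmeas (fun x => f x - g x).
Proof.
move=> bf bg; have := bmeas_lin (-1) bg bf.
by under eq_fun do rewrite mulN1r addrC.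
Qed.

Lemma bmeasM f g : bmeas f -> bmeas g -> bmeas (fun x => f x * g x).
Proof.
move=> [mf [M fM]] [mg [N gN]]; split; first exact: measurable_funM.
by exists (M * N) => x; rewrite normrM ler_pM.
Qed.

Lemma bmeas_indic (A : set T) : measurable A -> bmeas (\1_A : T -> R).
Proof.
move=> mA; split; first exact: measurable_indic.
by exists 1 => x; rewrite indicE; case: (x \in A); rewrite ?normr1 ?normr0.
Qed.

Lemma bmeas_sum (I : Type) (r : seq I) (P : pred I) (F : I -> T -> R) :
  (forall i, bmeas (F i)) -> bmeas (fun x => \sum_(i <- r | P i) F i x).
Proof.
move=> bF; elim: r => [|i r ih].
  by under eq_fun do rewrite big_nil; exact: bmeas_cst.
under eq_fun do rewrite big_cons; case: (P i) => //.
exact: bmeasD.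
Qed.

Lemma bmeas_integrable (m : {finite_measure set T -> \bar R}) f : bmeas f ->
  m.-integrable setT (EFin \o f).
Proof.
move=> [mf [M fM]]; apply: measurable_bounded_integrable => //.
  by rewrite -ge0_fin_numE// fin_num_measure.
exists M; split; first exact: num_real.
by move=> x Mx t _ /=; rewrite (le_trans (fM t))// ltW.
Qed.

Section functional_theory.
Variables (L : (T -> R) -> R) (C : R).
Hypothesis bL : bfunctional L C.

Lemma bf0 : L (fun _ => 0) = 0.
Proof.
have := bf_lin bL (-1) (bmeas_cst 0) (bmeas_cst 0).
under eq_fun do rewrite mulr0 addr0.
by rewrite mulN1r addNr.
Qed.

Lemma bfZ a f : bmeas f -> L (fun x => a * f x) = a * L f.
Proof.
move=> bf; have := bf_lin bL a bf (bmeas_cst 0).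
by rewrite bf0 addr0; under eq_fun do rewrite addr0.
Qed.

Lemma bfD f g : bmeas f -> bmeas g -> L (fun x => f x + g x) = L f + L g.
Proof.
move=> bf bg; have := bf_lin bL 1 bf bg; under eq_fun do rewrite mul1r.
by rewrite mul1r.
Qed.

Lemma bfB f g : bmeas f -> bmeas g -> L (fun x => f x - g x) = L f - L g.
Proof.
move=> bf bg; have := bf_lin bL (-1) bg bf; under eq_fun do rewrite mulN1r addrC.
by rewrite mulN1r addrC.
Qed.

Lemma bf_sum (I : Type) (r : seq I) (P : pred I) (c : I -> R) (F : I -> T -> R) :
  (forall i, bmeas (F i)) ->
  L (fun x => \sum_(i <- r | P i) c i * F i x) =
  \sum_(i <- r | P i) c i * L (F i).
Proof.
move=> bF; elim: r => [|i r ih].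
  by rewrite big_nil -[RHS]bf0; congr L; apply/funext => x; rewrite big_nil.
rewrite big_cons -ih; under eq_fun do rewrite big_cons.
case: (P i) => //; rewrite (bf_lin bL)//.
by apply: bmeas_sum => j; exact: bmeasZ.
Qed.

Lemma bf_dist f g e : bmeas f -> bmeas g -> (forall x, `|f x - g x| <= e) ->
  `|L f - L g| <= C * e.
Proof. by move=> bf bg fg; rewrite -bfB//; apply: (bf_le bL) => //; exact: bmeasB. Qed.

End functional_theory.

Lemma bfunctional_integral (m : {finite_measure set T -> \bar R}) :
  bfunctional (fun f => \int[m]_x f x) (fine (m setT)).
Proof.
split=> [|a f g bf bg|f M bf fM]; first exact: fine_ge0.
- rewrite RintegralD//; [|exact/bmeas_integrable/bmeasZ|exact: bmeas_integrable].
  by rewrite RintegralZl//; exact: bmeas_integrable.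
- have int := bmeas_integrable m bf.
  rewrite (le_trans (le_normr_Rintegral _ _))//.
  rewrite mulrC -(Rintegral_cst m measurableT) le_Rintegral//.
    exact: integrable_norm int.
  exact: (bmeas_integrable m (bmeas_cst M)).
Qed.

Lemma bfunctional_lin a b L1 C1 L2 C2 : bfunctional L1 C1 -> bfunctional L2 C2 ->
  bfunctional (fun f => a * L1 f + b * L2 f) (`|a| * C1 + `|b| * C2).
Proof.
move=> b1 b2; split=> [|c f g bf bg|f M bf fM].
- by rewrite addr_ge0// mulr_ge0// ?(bf_ge0 b1) ?(bf_ge0 b2).
- by rewrite (bf_lin b1)// (bf_lin b2)//; ring.
- rewrite (le_trans (ler_normD _ _))// mulrDl !normrM -!mulrA.
  by rewrite lerD// ler_wpM2l// ?(bf_le b1) ?(bf_le b2).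
Qed.

Lemma Rintegral_indic (m : {finite_measure set T -> \bar R}) (A : set T) :
  measurable A -> \int[m]_x (\1_A x : R) = fine (m A).
Proof. by move=> mA; rewrite /Rintegral integral_indic// setIT. Qed.

Lemma bfunctional_density (m : {finite_measure set T -> \bar R}) h : bmeas h ->
  exists C, bfunctional (fun f => \int[m]_x (f x * h x)) C.
Proof.
move=> bh; have [_ [N hN]] := bh; exists (fine (m setT) * `|N|).
have bm := bfunctional_integral m.
split=> [|a f g bf bg|f M bf fM].
- by rewrite mulr_ge0// (bf_ge0 bm).
- rewrite -(bf_lin bm); [|exact: bmeasM..].
  by apply: eq_Rintegral => x _; ring.
- rewrite -mulrA [_ * M]mulrC; apply: (bf_le bm); first exact: bmeasM.
  move=> x; rewrite normrM ler_pM// (le_trans (hN x))// ler_norm//.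
Qed.

Implicit Types nu : {charge set T -> \bar R}.

Lemma bfunctional_charge nu : exists C, bfunctional (charge_integral nu) C.
Proof.
have := bfunctional_lin 1 (-1) (bfunctional_integral (pos_part nu))
  (bfunctional_integral (neg_part nu)).
rewrite (_ : (fun f => _) = charge_integral nu); last first.
  by apply/funext => f; rewrite mul1r mulN1r.
by move=> H; eexists; exact: H.
Qed.

Lemma charge_integral_indic nu (A : set T) : measurable A ->
  charge_integral nu \1_A = fine (nu A).
Proof.
move=> mA; rewrite /charge_integral !Rintegral_indic//.
rewrite (jordan_decomp (svalP (hahn_ex nu)) mA).
rewrite /cadd/= cscaleN1 /= -fineN -fineD//; last 2 first.
- exact: fin_num_measure.
- by rewrite fin_numN fin_num_measure.
Qed.

End bounded_functionals.

(** * Uniformly continuous kernels, Riemann sums for energies *)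

(** The cells of a partition obtained by assigning each point to the first set
    of a finite cover that contains it are measurable. *)
Lemma measurable_find {d} {T : measurableType d} (I : Type) (B : I -> set T)
    (s : seq I) (i : nat) : (forall p, measurable (B p)) ->
  measurable [set x | find (fun p => x \in B p) s = i].
Proof.
move=> mB; elim: s i => [|p s ih] i /=.
  by case: i => [|i]; [rewrite (_ : mkset _ = setT)//; apply/seteqP; split
                     | rewrite (_ : mkset _ = set0)//; apply/seteqP; split].
case: i => [|i].
  rewrite (_ : mkset _ = B p)//; apply/seteqP; split => x /=.
    by case: ifP => // /set_mem.
  by move=> /mem_set ->.
rewrite (_ : mkset _ = ~` B p `&` [set x | find (fun p => x \in B p) s = i]).
  by apply: measurableI => //; exact: measurableC.
apply/seteqP; split => x /=.
  by case: ifPn => // /negP xp [] <-; split => // /mem_set.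
by case=> xp <-; case: ifPn => // /set_mem.
Qed.

Section uniform_kernels.
Context {R : realType} {Omega : pmetricType R}.
Implicit Types (f : Omega -> R) (k : Omega -> Omega -> R) (x y z : Omega).

Definition ucont f := forall e : R, 0 < e ->
  exists2 del, 0 < del & forall x y, ball x del y -> `|f x - f y| <= e.

Definition symk k := forall x y, k x y = k y x.

(** The modulus in the first variable is uniform in the second one; in this form
    it is inherited by potentials and by iterated kernels. *)
Definition ukernel k := symk k /\ forall e : R, 0 < e ->
  exists2 del, 0 < del &
    forall x y, ball x del y -> forall z, `|k x z - k y z| <= e.

Lemma ukernel_ucont k y : ukernel k -> ucont (k ^~ y).
Proof.
by move=> [_ uk] e /uk[del d0 H]; exists del => // x x' /H.
Qed.

Lemma open_measurable_borel (A : set (borel Omega)) :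
  @open Omega A -> measurable A.
Proof. by move=> oA; apply: sub_sigma_algebra. Qed.

Lemma ucont_measurable f : ucont f -> measurable_fun setT (f : borel Omega -> R).
Proof.
move=> uf; have cf : continuous f.
  move=> x; apply/cvgrPdist_le => e /uf[del d0 H].
  by apply/nbhs_ballP; exists del => // y /H.
apply: (measurability _ (RGenOpens.measurableE R)).
move=> _ [_ [a [b ->]] <-]; rewrite setTI; apply: open_measurable_borel.
by move/continuousP: cf; apply; exact: interval_open.
Qed.

Hypothesis cptO : compact [set: Omega].

(** The cells of the partition are the fibres of [idx], and [p i] is a centre of
    cell [i], so that [f \o p \o idx] is the step function approximating [f]. *)
Lemma small_partition del : 0 < del -> exists (n : nat) (p : 'I_n -> Omega)
    (idx : Omega -> 'I_n),
  (forall i, measurable (idx @^-1` [set i] : set (borel Omega))) /\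
  forall x, ball (p (idx x)) del x.
Proof.
move=> d0; have := cptO; rewrite compact_cover.
pose B (x : Omega) : set (borel Omega) := (ball x del)°.
have oB x : @open Omega (B x) by exact: open_interior.
move=> /(_ _ setT B (fun x _ => oB x)) [].
  by move=> x _; exists x => //; rewrite /B /interior; exact: nbhsx_ballx.
move=> D _ Dcov; pose s := enum_fset D.
pose fd (x : Omega) := find (fun p => x \in B p) s.
have fdlt x : (fd x < size s)%N.
  have [p pD Bpx] := Dcov x I.
  by rewrite -has_find; apply/hasP; exists p => //; exact/mem_set.
exists (size s), (fun i => nth point s i), (fun x => Ordinal (fdlt x)).
split=> [i|x].
  rewrite (_ : _ @^-1` _ = [set x | fd x = i]); last first.
    by apply/seteqP; split => x /= => [<-//|H]; exact/val_inj.
  by apply: measurable_find => p; exact: open_measurable_borel.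
have : x \in B (nth point s (fd x)).
  by rewrite (@nth_find _ _ (fun p => x \in B p))// has_find fdlt.
by move=> /set_mem /interior_subset.
Qed.

Lemma ucont_bmeas f : ucont f -> bmeas (f : borel Omega -> R).
Proof.
move=> uf; split; first exact: ucont_measurable.
have [del d0 H] := uf 1 ltr01.
have [n [p [idx [_ pb]]]] := small_partition d0.
exists (\sum_i `|f (p i)| + 1) => x.
rewrite -[f x](subrK (f (p (idx x)))) addrC (le_trans (ler_normD _ _))//.
rewrite lerD//; last by rewrite distrC H.
by rewrite (bigD1 (idx x))//= lerDl sumr_ge0.
Qed.

(** Heine-Cantor: the near-covering form of compactness of the product gives a
    radius that works near every point of the product at once. *)
Lemma kernel_function_ukernel (K : Omega * Omega -> R) : kernel_function K ->
  ukernel (fun x y => K (x, y)).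
Proof.
move=> [cK sK]; split=> [x y|e e0]; first exact: sK.
pose P (del : R) (w : Omega * Omega) :=
  forall y, ball w.1 del y -> `|K w - K (y, w.2)| <= e.
have cpt2 : compact [set: Omega * Omega].
  by rewrite -setXTT; exact: compact_setX.
have near_P : \forall del \near 0^'+, [set: Omega * Omega] `<=` P del.
  apply: (@compact_near_coveringP _ _).1 => // w _.
  have e20 : 0 < e / 2 by rewrite divr_gt0.
  have /cvgrPdist_le/(_ _ e20) := cK w.
  move=> /nbhs_ballP[r /= r0 Hr].
  have r2r : r / 2 <= r by rewrite ler_pdivrMr// mulr_natr mulr2n lerDl ltW.
  exists (ball w (r / 2), [set del | 0 < del < r / 2]).
    split=> /=; first by apply: nbhsx_ballx; rewrite divr_gt0.
    near=> u; apply/andP; split; near: u; [exact: nbhs_right_gt|].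
    by apply: nbhs_right_lt; rewrite divr_gt0.
  move=> [w' u] /= [ww' /andP[u0 ur]] y w'y.
  rewrite -(subrKA (K w)) (le_trans (ler_normD _ _))// [leRHS]splitr lerD//.
    by rewrite distrC Hr//; exact: le_ball ww'.
  apply: Hr; split => /=; last exact: le_ball ww'.2.
  by rewrite (splitr r); apply: ball_triangle ww'.1 _; apply: le_ball w'y; exact: ltW.
have /filter_ex[del [d0 H]] : \forall del \near 0^'+, 0 < del /\
    [set: Omega * Omega] `<=` P del.
  by near=> del; split; near: del => //; exact: nbhs_right_gt.
by exists del => // x y xy z; exact: (H (x, z)).
Unshelve. all: by end_near. Qed.

Lemma ukernel_bmeas k y : ukernel k -> bmeas (fun x : borel Omega => k x y).
Proof. by move=> uk; apply: ucont_bmeas; exact: ukernel_ucont. Qed.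

Lemma bmeas_idx n (idx : borel Omega -> 'I_n) (c : 'I_n -> R) :
  (forall i, measurable (idx @^-1` [set i])) -> bmeas (fun x : borel Omega => c (idx x)).
Proof.
move=> mA.
rewrite (_ : (fun x => _) = fun x =>
  \sum_i c i * (\1_(idx @^-1` [set i]) : borel Omega -> R) x); last first.
  apply/funext => x; rewrite (bigD1 (idx x))//= big1 => [|i /eqP ix].
    by rewrite indicE mem_set// mulr1 addr0.
  by rewrite indicE memNset ?mulr0// => /= /esym.
by apply: bmeas_sum => i; apply: bmeasZ; exact: bmeas_indic.
Qed.

Lemma bf_idx (L : (borel Omega -> R) -> R) (C : R) n (idx : borel Omega -> 'I_n) (c : 'I_n -> R) :
  bfunctional L C -> (forall i, measurable (idx @^-1` [set i])) ->
  L (fun x : borel Omega => c (idx x)) = \sum_i c i * L (\1_(idx @^-1` [set i])).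
Proof.
move=> bL mA; rewrite -(bf_sum bL); last by move=> i; exact: bmeas_indic.
congr L; apply/funext => x; rewrite (bigD1 (idx x))//= big1 => [|i /eqP ix].
  by rewrite indicE mem_set// mulr1 addr0.
by rewrite indicE memNset ?mulr0// => /= /esym.
Qed.

(** Both functionals take the same value on the step functions that approximate
    [f] uniformly. *)
Lemma bf_ext_ucont (L1 L2 : (borel Omega -> R) -> R) (C1 C2 : R) f :
  bfunctional L1 C1 -> bfunctional L2 C2 ->
  (forall A, measurable A -> L1 \1_A = L2 \1_A) -> ucont f -> L1 f = L2 f.
Proof.
move=> b1 b2 L12 uf; apply/eqP; rewrite -subr_eq0 -normr_le0.
apply/ler_addgt0Pr => e e0; rewrite add0r.
have C0 : 0 < C1 + C2 + 1 by rewrite ltr_wpDl// addr_ge0 ?(bf_ge0 b1) ?(bf_ge0 b2).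
have [del d0 fd] := uf _ (divr_gt0 e0 C0).
have [n [p [idx [mA pb]]]] := small_partition d0.
pose g x := f (p (idx x)).
have bg : bmeas (g : borel Omega -> R) by exact: (@bmeas_idx n idx (fun i => f (p i)) mA).
have bf := ucont_bmeas uf.
have fg x : `|f x - g x| <= e / (C1 + C2 + 1) by rewrite distrC fd.
have Lg : L1 g = L2 g.
  rewrite /g (bf_idx (fun i => f (p i)) b1 mA) (bf_idx (fun i => f (p i)) b2 mA).
  by apply: eq_bigr => i _; rewrite L12.
have := bf_dist b2 bf bg fg; rewrite distrC -Lg => H2.
rewrite -(subrKA (L1 g)) (le_trans (ler_normD _ _))//.
rewrite (le_trans (lerD (bf_dist b1 bf bg fg) H2))//.
rewrite -mulrDl mulrCA ger_pMr// ler_pdivrMr// mul1r.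
by rewrite lerDl.
Qed.

Lemma potential_ucont k (L : (borel Omega -> R) -> R) (C : R) : ukernel k -> bfunctional L C ->
  ucont (fun y => L (fun x : borel Omega => k x y)).
Proof.
move=> uk bL e e0.
have C0 : 0 < C + 1 by rewrite ltr_wpDl// (bf_ge0 bL).
have [del d0 kd] := uk.2 _ (divr_gt0 e0 C0); exists del => // y y' yy'.
have H x : `|k x y - k x y'| <= e / (C + 1) by rewrite !(uk.1 x) kd.
rewrite (le_trans (bf_dist bL (ukernel_bmeas y uk) (ukernel_bmeas y' uk) H))//.
by rewrite mulrCA ger_pMr// ler_pdivrMr// mul1r lerDl.
Qed.

(** The mutual energy of two charges is the case of their integrals. *)
Definition bienergy k (L1 L2 : (borel Omega -> R) -> R) :=
  L2 (fun y => L1 (fun x => k x y)).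

(** Replacing [k x y] by its value at the centres of the cells of [x] and [y]
    changes it by at most [e], hence the bienergy by at most [C1 * C2 * e].  The
    partition depends on [k] and [e] only, so that several functionals can be
    compared on the same partition. *)
Lemma bienergy_approx k (e : R) : ukernel k -> 0 < e ->
  exists (n : nat) (p : 'I_n -> Omega) (A : 'I_n -> set (borel Omega)),
  (forall i, measurable (A i)) /\
  forall (L1 L2 : (borel Omega -> R) -> R) (C1 C2 : R), bfunctional L1 C1 -> bfunctional L2 C2 ->
  `|bienergy k L1 L2 -
    \sum_i \sum_j (L1 \1_(A i) * L2 \1_(A j) * k (p i) (p j))| <= C1 * C2 * e.
Proof.
move=> uk e0; have e20 : 0 < e / 2 by rewrite divr_gt0.
have [del d0 kd] := uk.2 _ e20.
have [n [p [idx [mA pb]]]] := small_partition d0.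
exists n, p, (fun i => idx @^-1` [set i]); split => // L1 L2 C1 C2 b1 b2.
pose k' x y := k (p (idx x)) (p (idx y)).
have kk' x y : `|k x y - k' x y| <= e.
  rewrite -(subrKA (k x (p (idx y)))) (le_trans (ler_normD _ _))// [leRHS]splitr.
  rewrite lerD//; first by rewrite !(uk.1 x) distrC kd.
  by rewrite distrC kd.
have bk' y : bmeas (fun x : borel Omega => k' x y).
  exact: (@bmeas_idx n idx (fun i => k (p i) (p (idx y))) mA).
pose c j := \sum_i k (p i) (p j) * L1 (\1_(idx @^-1` [set i])).
have L1k' y : L1 (k' ^~ y) = c (idx y).
  by rewrite /k' (bf_idx (fun i => k (p i) (p (idx y))) b1 mA).
have bL1k' : bmeas (fun y : borel Omega => L1 (k' ^~ y)).
  by rewrite (funext L1k'); exact: (@bmeas_idx n idx c mA).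
rewrite (_ : \sum_i _ = bienergy k' L1 L2).
  rewrite /bienergy -mulrA mulrCA; apply: (bf_dist b2) => //.
    by apply: ucont_bmeas; exact: potential_ucont b1.
  move=> y; apply: (bf_dist b1) => //; exact: ukernel_bmeas.
rewrite /bienergy (funext L1k').
rewrite (bf_idx c b2 mA) /c.
rewrite exchange_big; apply: eq_bigr => j _.
by rewrite mulr_suml; apply: eq_bigr => i _; ring.
Qed.

(** The approximating double sums are symmetric, since [k] is; this replaces
    Fubini's theorem for charges. *)
Lemma bienergyC k (L1 L2 : (borel Omega -> R) -> R) (C1 C2 : R) : ukernel k -> bfunctional L1 C1 ->
  bfunctional L2 C2 -> bienergy k L1 L2 = bienergy k L2 L1.
Proof.
move=> uk b1 b2; apply/eqP; rewrite -subr_eq0 -normr_le0.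
apply/ler_addgt0Pr => e e0; rewrite add0r.
have C120 : 0 <= C1 * C2 by rewrite mulr_ge0 ?(bf_ge0 b1) ?(bf_ge0 b2).
have C0 : 0 < 2 * (C1 * C2) + 1 by rewrite ltr_wpDl// mulr_ge0.
have [n [p [A [_ H]]]] := bienergy_approx uk (divr_gt0 e0 C0).
have H1 := H _ _ _ _ b1 b2; have := H _ _ _ _ b2 b1.
rewrite [X in _ - X](_ : _ = \sum_i \sum_j (L1 \1_(A i) * L2 \1_(A j) * k (p i) (p j))).
  rewrite distrC => H2.
  rewrite -(subrKA (\sum_i \sum_j (L1 \1_(A i) * L2 \1_(A j) * k (p i) (p j)))).
  rewrite (le_trans (ler_normD _ _))// (le_trans (lerD H1 H2))//.
  rewrite [C2 * C1]mulrC -mulrDl -mulr2n -[_ *+ 2]mulr_natl mulrCA ger_pMr//.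
  by rewrite ler_pdivrMr// mul1r lerDl.
rewrite exchange_big; apply: eq_bigr => i _; apply: eq_bigr => j _.
by rewrite [k (p j) _]uk.1; ring.
Qed.

(** A list of pairs of a weight and a point stands for a finitely supported
    signed measure, and the sum is its energy. *)
Definition psd k := forall s : seq (R * Omega),
  0 <= \sum_(a <- s) \sum_(b <- s) a.1 * b.1 * k a.2 b.2.

Lemma psd_bienergy k (L : (borel Omega -> R) -> R) (C : R) :
  ukernel k -> psd k -> bfunctional L C ->
  0 <= bienergy k L L.
Proof.
move=> uk pk bL; apply/ler_addgt0Pr => e e0.
have C0 : 0 < C * C + 1 by rewrite ltr_wpDl// mulr_ge0// (bf_ge0 bL).
have [n [p [A [_ /(_ _ _ _ _ bL bL)]]]] := bienergy_approx uk (divr_gt0 e0 C0).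
set S := \sum_i _ => H.
have S0 : 0 <= S.
  have := pk [seq (L \1_(A i), p i) | i <- enum 'I_n].
  rewrite big_map big_enum/=; under eq_bigr do rewrite big_map big_enum/=.
  by [].
have : C * C * (e / (C * C + 1)) <= e.
  by rewrite mulrCA ger_pMr// ler_pdivrMr// mul1r lerDl.
by move: H; rewrite ler_distl => /andP[+ _]; lra.
Qed.

End uniform_kernels.

(** * Energies of charges *)

Section charges.
Context {R : realType} {Omega : pmetricType R}.
Implicit Types (f : Omega -> R) (k : Omega -> Omega -> R) (x y z : Omega).
Implicit Types (K : Omega * Omega -> R).
Implicit Types (L : (borel Omega -> R) -> R) (C a b : R).
Implicit Types (mu nu : {charge set (borel Omega) -> \bar R}).

Lemma total_variation_eq0 nu (B : set (borel Omega)) : measurable B ->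
  (forall D, measurable D -> D `<=` B -> nu D = 0%E) -> Defs.total_variation nu B = 0%E.
Proof.
move=> mB nuB; rewrite /Defs.total_variation.
case: (hahn_ex nu) => -[P N] hPN; have [[mP _] [mN _] _ _] := hPN.
have p0 : jordan_pos hPN B = 0%E.
  rewrite jordan_posE cjordan_posE /crestr0 mem_set// /crestr.
  by apply: nuB => [|x []//]; exact: measurableI.
have n0 : jordan_neg hPN B = 0%E.
  rewrite jordan_negE cjordan_negE /crestr0 mem_set// /crestr nuB; first exact: oppe0.
    by exact: measurableI.
  by move=> x [].
transitivity (jordan_pos hPN B + jordan_neg hPN B)%E; first by [].
by rewrite p0 n0 adde0.
Qed.

Lemma closed_finite (S : set Omega) : finite_set S -> closed S.
Proof.
move=> fS; apply: compact_closed; first exact: metric_hausdorff.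
exact: finite_compact.
Qed.

(** If a charge lives on a finite set [S], then up to null sets a set [A] is the
    compact set [S `&` A], and it is contained in the open set of points outside
    [S `\` A]. *)
Lemma finitely_supported_regular nu (S : set Omega) : finite_set S ->
  (forall D : set (borel Omega), measurable D -> D `<=` ~` S -> nu D = 0%E) ->
  regular_charge nu.
Proof.
move=> fS nuS A mA.
have mfin (F : set Omega) : finite_set F -> measurable (F : set (borel Omega)).
  move=> /closed_finite cF; rewrite -(setCK F); apply: measurableC.
  by apply: open_measurable_borel; exact: closed_openC.
have TV0 (B : set (borel Omega)) : measurable B -> B `<=` ~` S ->
    Defs.total_variation nu B = 0%E.
  by move=> mB BS; apply: total_variation_eq0 => // D mD DB; apply: nuS => // x /DB /BS.
have TVle (B D : set (borel Omega)) : measurable B -> measurable D -> B `<=` D ->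
    (Defs.total_variation nu B <= Defs.total_variation nu D)%E.
  by move=> mB mD BD; apply: le_measure => //; exact: mem_set.
have fI (F : set Omega) : finite_set (S `&` F) by apply: sub_finite_set fS => x [].
have TVE (B : set (borel Omega)) : measurable B ->
    Defs.total_variation nu B = Defs.total_variation nu (S `&` B).
  move=> mB; rewrite [LHS](measureDI _ mB (mfin _ fS)) setIC.
  have mBS : measurable (B `\` S) by apply: measurableD => //; exact: mfin.
  have BS0 : Defs.total_variation nu (B `\` S) = 0%E by apply: TV0 => // x [].
  by rewrite [X in (X + _)%E]BS0 add0e.
split; apply/eqP; rewrite eq_le; apply/andP; split.
- apply: le_ereal_inf_tmp => _ [U [oU AU] <-]; apply: TVle => //.
  exact: open_measurable_borel.
- apply: ereal_inf_lbound; exists (~` (S `&` ~` A)).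
    split; first by apply: closed_openC; exact: closed_finite.
    by move=> x Ax [].
  rewrite [RHS]TVE// TVE; last by apply: measurableC; exact: mfin.
  congr (Defs.total_variation nu _); apply/seteqP; split => x [Sx].
    by move=> H; split => //; apply: contrapT => nA; exact: H.
  by move=> Ax; split => // -[].
- apply: ereal_sup_ubound; exists (S `&` A); last by rewrite -TVE.
  by split; [exact: finite_compact | move=> x []].
- apply: ge_ereal_sup => _ [F [cF FA] <-]; apply: TVle => //.
  rewrite -(setCK F); apply: measurableC; apply: open_measurable_borel.
  by apply: closed_openC; apply: compact_closed => //; exact: metric_hausdorff.
Qed.

Fixpoint discrete_charge (s : seq (R * Omega)) :
    {charge set (borel Omega) -> \bar R} :=
  if s is w :: s' then
    cadd (cscale w.1 (charge_of_finite_measure (@dirac _ (borel Omega) w.2 R)))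
         (discrete_charge s')
  else czero.

Lemma discrete_chargeE s (A : set (borel Omega)) :
  discrete_charge s A = (\sum_(w <- s) w.1 * \1_A w.2)%:E.
Proof.
elim: s => [|w s ih] /=; first by rewrite big_nil.
by rewrite /cadd /cscale /= ih big_cons EFinD EFinM.
Qed.

Lemma discrete_charge_regular s : regular_charge (discrete_charge s).
Proof.
apply: (@finitely_supported_regular _ [set` map snd s]) => [|D mD DS].
  exact: finite_seq.
rewrite discrete_chargeE big_seq big1// => w ws.
rewrite indicE memNset ?mulr0// => /DS; apply => /=.
by apply/mapP; exists w.
Qed.

Lemma bfunctional_points (s : seq (R * Omega)) :
  bfunctional (fun f : borel Omega -> R => \sum_(w <- s) w.1 * f w.2)
    (\sum_(w <- s) `|w.1|).
Proof.
split=> [|a f g _ _|f M _ fM]; first exact: sumr_ge0.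
  by rewrite mulr_sumr -big_split; apply: eq_bigr => w _; rewrite /=; ring.
rewrite (le_trans (ler_norm_sum _ _ _))// mulr_suml ler_sum// => w _.
by rewrite normrM ler_wpM2l.
Qed.

Hypothesis cptO : compact [set: Omega].

Lemma bienergy_ext k L C L' C' : ukernel k -> bfunctional L C ->
  bfunctional L' C' -> (forall A, measurable A -> L \1_A = L' \1_A) ->
  bienergy k L L = bienergy k L' L'.
Proof.
move=> uk bL bL' LL'; rewrite /bienergy.
rewrite (bf_ext_ucont cptO bL bL' LL'); last exact: potential_ucont bL.
congr L'; apply/funext => y; apply: (bf_ext_ucont cptO bL bL' LL').
exact: ukernel_ucont.
Qed.

Lemma bienergy_lin k L1 C1 L2 C2 a b : ukernel k -> bfunctional L1 C1 ->
  bfunctional L2 C2 ->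
  bienergy k (fun f => a * L1 f + b * L2 f) (fun f => a * L1 f + b * L2 f) =
  a ^+ 2 * bienergy k L1 L1 + 2 * a * b * bienergy k L1 L2 +
  b ^+ 2 * bienergy k L2 L2.
Proof.
move=> uk b1 b2.
have bp L C : bfunctional L C -> bmeas (fun y : borel Omega => L (fun x => k x y)).
  by move=> bL; apply: ucont_bmeas => //; exact: potential_ucont bL.
have E21 := bienergyC cptO uk b2 b1.
rewrite {1}/bienergy (bf_lin b1); [|exact: bp b1|exact: bmeasZ (bp _ _ b2)].
rewrite (bf_lin b2); [|exact: bp b1|exact: bmeasZ (bp _ _ b2)].
rewrite !(bfZ b1, bfZ b2); [|exact: bp b2..].
by rewrite /bienergy in E21 *; rewrite E21; ring.
Qed.

Lemma energy_lin K mu nu a b : ukernel (fun x y => K (x, y)) ->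
  energy K (cadd (cscale a mu) (cscale b nu)) =
  a ^+ 2 * energy K mu + 2 * a * b * mutual_energy K mu nu + b ^+ 2 * energy K nu.
Proof.
move=> uk; have [C1 b1] := bfunctional_charge mu.
have [C2 b2] := bfunctional_charge nu.
have [C bL] := bfunctional_charge (cadd (cscale a mu) (cscale b nu)).
rewrite -[mutual_energy K mu nu]/(bienergy _ _ _) -[energy K mu]/(bienergy _ _ _).
rewrite -[energy K nu]/(bienergy _ _ _) -(bienergy_lin _ _ uk b1 b2).
apply: (bienergy_ext uk bL (bfunctional_lin a b b1 b2)) => A mA.
rewrite !charge_integral_indic// /cadd/= /cscale/=.
have fmu : mu A \is a fin_num by exact: fin_num_measure.
have fnu : nu A \is a fin_num by exact: fin_num_measure.
by rewrite fineD ?fin_numM// !fineM.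
Qed.

Lemma energy_discrete K s : ukernel (fun x y => K (x, y)) ->
  energy K (discrete_charge s) =
  \sum_(v <- s) \sum_(w <- s) v.1 * w.1 * K (v.2, w.2).
Proof.
move=> uk; have [C bL] := bfunctional_charge (discrete_charge s).
have -> : energy K (discrete_charge s) = bienergy (fun x y => K (x, y))
    (fun f => \sum_(w <- s) w.1 * f w.2) (fun f => \sum_(w <- s) w.1 * f w.2).
  apply: (bienergy_ext uk bL (bfunctional_points s)) => A mA.
  by rewrite charge_integral_indic// discrete_chargeE.
rewrite /bienergy exchange_big; apply: eq_bigr => w _ /=.
by rewrite mulr_sumr; apply: eq_bigr => v _; ring.
Qed.

Lemma psd_energy_ge0 K nu : ukernel (fun x y => K (x, y)) ->
  psd (fun x y => K (x, y)) -> 0 <= energy K nu.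
Proof.
by move=> uk pk; have [C bL] := bfunctional_charge nu; exact: (psd_bienergy cptO uk pk bL).
Qed.

Lemma positive_definite_psd K : ukernel (fun x y => K (x, y)) ->
  positive_definite K <-> psd (fun x y => K (x, y)).
Proof.
move=> uk; split=> [pK s|pk nu _]; last exact: psd_energy_ge0.
by have := pK _ (discrete_charge_regular s); rewrite energy_discrete.
Qed.

(** Compare the midpoint of a charge [nu] and the zero charge with its endpoints:
    [energy nu / 4 <= energy nu / 2]. *)
Lemma energy_convex_psd K : ukernel (fun x y => K (x, y)) ->
  energy_convex K -> psd (fun x y => K (x, y)).
Proof.
move=> uk cK s; rewrite -energy_discrete//.
have h2 : (0 <= 1 / 2 :> R) && (1 / 2 <= 1 :> R) by apply/andP; split; lra.
have := cK _ _ (discrete_charge_regular s) (discrete_charge_regular [::]) _ h2.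
rewrite energy_lin// [energy K (discrete_charge [::])]energy_discrete// big_nil.
rewrite (_ : mutual_energy _ _ _ = 0); first by lra.
rewrite /mutual_energy; have [C bL] := bfunctional_charge (discrete_charge s).
have [C' bL'] := bfunctional_charge (discrete_charge [::]).
rewrite (bf_ext_ucont cptO bL' (bfunctional_points [::])); first by rewrite big_nil.
  by move=> A mA; rewrite charge_integral_indic// discrete_chargeE.
exact: (potential_ucont cptO uk bL).
Qed.

(** The defect of convexity at [t] is [t * (1 - t)] times the energy of
    [mu - nu]. *)
Lemma psd_energy_convex K : ukernel (fun x y => K (x, y)) ->
  psd (fun x y => K (x, y)) -> energy_convex K.
Proof.
move=> uk pk mu nu _ _ t /andP[t0 t1]; rewrite energy_lin//.
have := psd_energy_ge0 (cadd (cscale 1 mu) (cscale (-1) nu)) uk pk.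
rewrite energy_lin// => H.
have : 0 <= t * (1 - t) by rewrite mulr_ge0// subr_ge0.
by move=> /mulr_ge0 /(_ H); lra.
Qed.

Lemma psd_cauchy_schwarz K mu nu : ukernel (fun x y => K (x, y)) ->
  psd (fun x y => K (x, y)) ->
  mutual_energy K mu nu <= Num.sqrt (energy K mu * energy K nu).
Proof.
move=> uk pk; set A := energy K mu; set B := mutual_energy _ _ _; set C := energy K nu.
have A0 : 0 <= A by exact: psd_energy_ge0.
have C0 : 0 <= C by exact: psd_energy_ge0.
have H a b : 0 <= a ^+ 2 * A + 2 * a * b * B + b ^+ 2 * C.
  by rewrite -energy_lin//; exact: psd_energy_ge0.
rewrite (le_trans (ler_norm _))// -sqrtr_sqr ler_wsqrtr//.
have [A0'|A0'] := eqVneq A 0; last first.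
  (* The energy of [A * nu - B * mu] is [A * (A * C - B ^+ 2)]. *)
  have {}A0 : 0 < A by rewrite lt_def A0'.
  have := H (- B) A; rewrite (_ : _ + _ = A * (A * C - B ^+ 2)); last by ring.
  by rewrite pmulr_rge0// subr_ge0.
rewrite A0' mul0r.
have [->|B0] := eqVneq B 0; first by rewrite expr0n.
(* If [A = 0] the form is affine in the first weight, which forces [B = 0]. *)
have := H (- (C + 1) / (2 * B)) 1; rewrite A0' mulr0 add0r mulr1 expr1n mul1r.
rewrite (_ : 2 * _ * B = - (C + 1)); first by lra.
by field.
Qed.

End charges.

(** * Energies of densities *)

Lemma mnormalize_total1 {d} {T : measurableType d} {R : realType}
    (m : {measure set T -> \bar R}) (P : probability T R) (A : set T) :
  m setT = 1%E -> mnormalize m P A = m A.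
Proof. by move=> m1; rewrite /mnormalize m1 onee_eq0/= invr1 mule1. Qed.

Section densities.
Context {R : realType} {Omega : pmetricType R}.
Variable mu : probability (borel Omega) R.
Implicit Types (f h : borel Omega -> R) (k : Omega -> Omega -> R).

(** The functional of integration against [h * mu], and not the measure itself. *)
Definition density h : (borel Omega -> R) -> R := fun f => \int[mu]_x (f x * h x).

Lemma bfunctional_mu : bfunctional (fun f => \int[mu]_x f x) 1.
Proof.
have := bfunctional_integral mu.
by rewrite [X in fine X](_ : _ = 1%E)//; exact: probability_setT.
Qed.

Lemma RintegralM_indic h (A : set (borel Omega)) : measurable A ->
  \int[mu]_x (\1_A x * h x) = \int[mu]_(x in A) h x.
Proof.
move=> mA; rewrite [RHS]Rintegral_mkcond; apply: eq_Rintegral => x _.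
by rewrite patchE indicE; case: (x \in A); rewrite ?mul1r ?mul0r.
Qed.

Lemma density_probability (w : borel Omega -> R) : bmeas w -> (forall x, 0 <= w x) ->
  \int[mu]_x w x = 1 ->
  exists P : probability (borel Omega) R, forall A, measurable A ->
    fine (P A) = density w \1_A.
Proof.
move=> bw w0 w1; pose D := induced_charge (bmeas_integrable mu bw).
have D0 A : (0 <= D A)%E by apply: integral_ge0 => x _; rewrite lee_fin.
have DT : D setT = 1%E.
  rewrite -[LHS]fineK; first by rewrite -w1.
  exact: (fin_num_measure _ _ measurableT).
pose M := measure_of_charge D D0.
have MT : M setT = 1%E by exact: DT.
exists (mnormalize M mu) => A mA.
have ME : mnormalize M mu A = M A.
  exact: mnormalize_total1.
by rewrite [LHS](congr1 fine ME) /density RintegralM_indic.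
Qed.

Hypothesis cptO : compact [set: Omega].

Lemma charge_of_probabilityE (P : probability (borel Omega) R) (f : Omega -> R) :
  ucont f -> charge_integral (charge_of_probability P) f = \int[P]_x f x.
Proof.
move=> uf; have [C bL] := bfunctional_charge (charge_of_probability P).
apply: (bf_ext_ucont cptO bL (bfunctional_integral P)) => // A mA.
by rewrite charge_integral_indic// Rintegral_indic.
Qed.

(** Write [h = g + m] with [g] of mean zero.  The mixed term in the energy of
    [mu + e * g * mu] is [e] times the integral of the constant potential against
    [g], hence zero, and this measure is a probability for small [e]; so minimality
    says that the energy of [g * mu] is nonnegative, and the energy of [h * mu] is
    the energy of [g * mu] plus [m ^+ 2] times that of [mu]. *)
Lemma minimizer_density (K : Omega * Omega -> R) h :
  ukernel (fun x y => K (x, y)) ->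
  invariant_measure K (charge_of_probability mu) ->
  (forall nu : probability (borel Omega) R,
     energy K (charge_of_probability mu) <= energy K (charge_of_probability nu)) ->
  0 <= energy K (charge_of_probability mu) ->
  bmeas h -> 0 <= bienergy (fun x y => K (x, y)) (density h) (density h).
Proof.
move=> uk inv minmu I0 bh; set k := fun x y => K (x, y).
set I := energy _ _ in I0 minmu inv.
pose L f := \int[mu]_x f x.
have bL : bfunctional L 1 by exact: bfunctional_mu.
have L1 c : L (fun=> c) = c.
  by rewrite /L Rintegral_cst// [X in fine X]probability_setT mulr1.
have pot y : L (fun x => k x y) = I.
  have uky := ukernel_ucont y uk; rewrite -/(L _) /L -charge_of_probabilityE//.
  rewrite -[RHS](inv y) /potential; congr charge_integral.
  by apply/funext => x; rewrite /k -(uk.1 x).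
have EI : bienergy k L L = I by rewrite /bienergy (funext pot) L1.
have bD f : bmeas f -> exists C, bfunctional (density f) C.
  by move=> bf; exact: bfunctional_density.
pose m := L h; pose g x := h x - m.
have bg : bmeas g by apply: bmeasB => //; exact: bmeas_cst.
have Lg : L g = 0 by rewrite (bfB bL)//; [rewrite L1 subrr | exact: bmeas_cst].
have [Cg bDg] := bD _ bg; have [Ch bDh] := bD _ bh.
have ELg : bienergy k L (density g) = 0.
  rewrite /bienergy (funext pot) /density -[RHS](mulr0 I) -Lg -(bfZ bL)//.
have Egg : 0 <= bienergy k (density g) (density g).
  have [_ [M gM]] := bg.
  have M0 : 0 < `|M| + 1 by rewrite ltr_wpDl.
  (* With this [e] the density [w] below is nonnegative. *)
  pose e := (`|M| + 1)^-1; have e0 : 0 < e by rewrite invr_gt0.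
  pose w x := e * g x + 1.
  have bw : bmeas w by apply: bmeas_lin => //; exact: bmeas_cst.
  have w0 x : 0 <= w x.
    have : `|e * g x| <= 1.
      rewrite normrM gtr0_norm// ler_pdivrMl// mulr1.
      by rewrite (le_trans (gM x))// (le_trans (ler_norm _))// lerDl.
    by rewrite ler_norml => /andP[+ _]; rewrite /w; lra.
  have w1 : \int[mu]_x w x = 1.
    by rewrite -/(L w) (bf_lin bL)// ?Lg ?mulr0 ?add0r ?L1//; exact: bmeas_cst.
  have [P PE] := density_probability bw w0 w1.
  have [C bP] := bfunctional_charge (charge_of_probability P).
  have bLe := bfunctional_lin 1 e bL bDg.
  have := minmu P; rewrite -[energy K _]/(bienergy k _ _).
  rewrite (bienergy_ext cptO uk bP bLe); last first.
    move=> A mA; rewrite charge_integral_indic// [fine _]PE// /density.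
    have bA := bmeas_indic mA.
    rewrite mul1r -(bfZ bL)//; last exact: bmeasM.
    rewrite -(bfD bL)//; last by apply: bmeasZ; exact: bmeasM.
    by apply: eq_Rintegral => x _; rewrite /w; ring.
  rewrite (bienergy_lin cptO _ _ uk bL bDg) EI ELg mulr0 addr0 expr1n mul1r.
  by rewrite lerDl pmulr_rge0// exprn_gt0.
rewrite (bienergy_ext cptO uk bDh (bfunctional_lin 1 m bDg bL)); last first.
  move=> A mA; have bA := bmeas_indic mA; rewrite /density mul1r -/(L _).
  rewrite -(bfZ bL)// -(bfD bL)//; [|exact: bmeasM|exact: bmeasZ].
  by apply: eq_Rintegral => x _; rewrite /g; ring.
rewrite (bienergy_lin cptO _ _ uk bDg bL) EI.
rewrite (bienergyC cptO uk bDg bL) ELg mulr0 addr0 expr1n mul1r.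
by rewrite addr_ge0// mulr_ge0// sqr_ge0.
Qed.

(** The density of the normalized restriction of [mu] to [B]. *)
Definition avg_density (B : set (borel Omega)) : borel Omega -> R :=
  fun x => (fine (mu B))^-1 * \1_B x.

Lemma bmeas_avg_density (B : set (borel Omega)) : measurable B ->
  bmeas (avg_density B).
Proof. by move=> mB; apply: bmeasZ; exact: bmeas_indic. Qed.

Lemma avg_density_ge (B : set (borel Omega)) f c : measurable B ->
  (0 < mu B)%E -> bmeas f -> (forall x, B x -> c <= f x) ->
  c <= density (avg_density B) f.
Proof.
move=> mB B0 bf fc; have bL := bfunctional_mu; set L := fun f => _ in bL.
have Bgt0 : 0 < fine (mu B) by rewrite fine_gt0// B0/= -ge0_fin_numE// fin_num_measure.
have bB := bmeas_avg_density mB.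
have L1 : L (avg_density B) = 1.
  rewrite (bfZ bL); last exact: bmeas_indic.
  by rewrite /L Rintegral_indic// mulVf// gt_eqF.
rewrite -[c]mulr1 -L1 -(bfZ bL)// le_Rintegral//.
- exact/bmeas_integrable/bmeasZ.
- exact/bmeas_integrable/bmeasM.
move=> x _; rewrite /avg_density indicE.
case: (boolP (x \in B)) => [/set_mem xB|_]; last by rewrite !mulr0.
by rewrite mulr1 ler_wpM2r// ?fc// invr_ge0 ltW.
Qed.

Lemma avg_density_dist (B : set (borel Omega)) f c e : measurable B ->
  (0 < mu B)%E -> bmeas f -> (forall x, B x -> `|f x - c| <= e) ->
  `|density (avg_density B) f - c| <= e.
Proof.
move=> mB B0 bf fc; have [C bL] := bfunctional_density mu (bmeas_avg_density mB).
have lo : c - e <= density (avg_density B) f.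
  by apply: avg_density_ge => // x /fc; rewrite ler_distl => /andP[].
have hi : - (c + e) <= density (avg_density B) (fun x => -1 * f x).
  apply: avg_density_ge => //; first exact: bmeasZ.
  by move=> x /fc; rewrite ler_distl mulN1r lerN2 => /andP[].
have hZ : density (avg_density B) (fun x => -1 * f x) = -1 * density (avg_density B) f.
  exact: (bfZ bL).
rewrite hZ mulN1r lerN2 in hi.
by rewrite ler_distl lo.
Qed.

Hypothesis full : measure_support mu = [set: Omega].

Lemma ball_gt0 x (del : R) : 0 < del -> (0 < mu (ball x del)°)%E.
Proof.
move=> d0; have : measure_support mu x by rewrite full.
apply; first exact: open_interior.
by rewrite /interior; exact: nbhsx_ballx.
Qed.

(** Full support allows one to replace the point masses at [w.2] by normalized
    restrictions of [mu] to small balls around [w.2], at a cost that tends to zero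
    by uniform continuity. *)
Lemma psd_of_density k : ukernel k ->
  (forall h, bmeas h -> 0 <= bienergy k (density h) (density h)) -> psd k.
Proof.
move=> uk kh s; pose S := \sum_(v <- s) \sum_(w <- s) `|v.1| * `|w.1|.
have S0 : 0 <= S by apply: sumr_ge0 => v _; apply: sumr_ge0 => w _; exact: mulr_ge0.
apply/ler_addgt0Pr => e e0.
have e20 : 0 < e / (S + 1) / 2 by rewrite !divr_gt0// ltr_wpDl.
have [del d0 kd] := uk.2 _ e20.
pose B (w : R * Omega) : set (borel Omega) := (ball w.2 del)°.
have mB w : measurable (B w) by apply: open_measurable_borel; exact: open_interior.
pose D w := density (avg_density (B w)).
have bB w : bmeas (avg_density (B w)) by apply: bmeasZ; exact: bmeas_indic.
have bD w : exists C, bfunctional (D w) C by exact: bfunctional_density.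
pose h x := \sum_(w <- s) w.1 * avg_density (B w) x.
have bh : bmeas h by apply: bmeas_sum => w; exact: bmeasZ.
have hE f : bmeas f -> density h f = \sum_(w <- s) w.1 * D w f.
  move=> bf; rewrite -(bf_sum bfunctional_mu); last by move=> w; exact: bmeasM.
  by apply: eq_Rintegral => x _; rewrite mulr_sumr; apply: eq_bigr => w _; ring.
have bp w : bmeas (fun y : borel Omega => D w (fun x => k x y)).
  by have [C bL] := bD w; apply: ucont_bmeas => //; exact: potential_ucont bL.
have kE : bienergy k (density h) (density h) =
    \sum_(v <- s) \sum_(w <- s) v.1 * w.1 * bienergy k (D v) (D w).
  rewrite /bienergy; under eq_fun do (rewrite hE; last exact: (ukernel_bmeas cptO _ uk)).
  pose F (w : R * Omega) (y : borel Omega) := w.1 * D w (fun x => k x y).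
  have bF w : bmeas (F w) by exact: bmeasZ.
  rewrite hE; last exact: (bmeas_sum s xpredT bF).
  rewrite exchange_big; apply: eq_bigr => w _; have [C bL] := bD w.
  by rewrite (bf_sum bL)// mulr_sumr; apply: eq_bigr => v _; ring.
have kvw v w : `|bienergy k (D v) (D w) - k v.2 w.2| <= e / (S + 1).
  apply: avg_density_dist => //; first exact: ball_gt0.
  move=> y yB; rewrite -(subrKA (k v.2 y)) (le_trans (ler_normD _ _))//.
  rewrite [leRHS]splitr lerD//.
    apply: avg_density_dist => //; [exact: ball_gt0|exact: ukernel_bmeas|].
    by move=> x /interior_subset xB; rewrite distrC kd.
  by rewrite !(uk.1 v.2) distrC kd//; exact: interior_subset yB.
have : `|\sum_(v <- s) \sum_(w <- s) v.1 * w.1 * k v.2 w.2 -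
    bienergy k (density h) (density h)| <= S * (e / (S + 1)).
  rewrite kE -sumrB /S mulr_suml (le_trans (ler_norm_sum _ _ _))// ler_sum// => v _.
  rewrite -sumrB mulr_suml (le_trans (ler_norm_sum _ _ _))// ler_sum// => w _.
  by rewrite -mulrBr !normrM ler_wpM2l// distrC.
have : S * (e / (S + 1)) <= e.
  by rewrite mulrCA ger_pMr// ler_pdivrMr ?mul1r ?lerDl// ltr_wpDl.
by rewrite ler_distl => ? /andP[]; have := kh _ bh; lra.
Qed.

End densities.

(** * Positive semidefinite kernels and their Schur complements *)

Lemma uniform_cvgnP {R : realType} {T : choiceType} (u : nat -> T -> R) (f : T -> R) :
  {uniform, u @ \oo --> f} <->
  (forall e : R, 0 < e -> \forall n \near \oo, forall x, `|f x - u n x| <= e).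
Proof.
split=> [uf e e0|uf].
  have : nbhs (f : {uniform T -> R}) [set h | forall x, `|f x - h x| <= e].
    apply/uniform_nbhs; exists [set z | `|z.1 - z.2| <= e]; split.
      by rewrite -entourage_ballE; exists e => //= z /ltW.
    by move=> h H x; exact: H.
  by move=> /uf.
move=> P /uniform_nbhs[E [+ EP]].
rewrite -entourage_ballE => -[e /= e0 eE].
have e20 : 0 < e / 2 by rewrite divr_gt0.
have := uf _ e20; apply: filterS => n un; apply: EP => x _; apply: eE => /=.
by rewrite -ball_normE /= (le_lt_trans (un x))// ltr_pdivrMr// mulr_natr mulr2n ltrDl.
Qed.

Section psd_kernels.
Context {R : realType} {Omega : pmetricType R}.
Implicit Types (k : Omega -> Omega -> R) (x y : Omega) (s : seq (R * Omega)).

(** The double sums for [k] and [k'] differ by at most [e] times the square of the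
    total absolute weight. *)
Lemma psd_approx k : (forall e : R, 0 < e ->
  exists2 k', psd k' & forall x y, `|k x y - k' x y| <= e) -> psd k.
Proof.
move=> H s; pose S := \sum_(v <- s) \sum_(w <- s) `|v.1| * `|w.1|.
have S0 : 0 <= S by apply: sumr_ge0 => v _; apply: sumr_ge0 => w _; exact: mulr_ge0.
have S1 : 0 < S + 1 by rewrite ltr_wpDl.
apply/ler_addgt0Pr => e e0.
have [k' pk' kk'] := H _ (divr_gt0 e0 S1).
have : `|\sum_(v <- s) \sum_(w <- s) v.1 * w.1 * k v.2 w.2 -
    \sum_(v <- s) \sum_(w <- s) v.1 * w.1 * k' v.2 w.2| <= S * (e / (S + 1)).
  rewrite -sumrB /S mulr_suml (le_trans (ler_norm_sum _ _ _))// ler_sum// => v _.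
  rewrite -sumrB mulr_suml (le_trans (ler_norm_sum _ _ _))// ler_sum// => w _.
  by rewrite -mulrBr !normrM ler_wpM2l.
have : S * (e / (S + 1)) <= e by rewrite mulrCA ger_pMr// ler_pdivrMr ?mul1r ?lerDl.
by rewrite ler_distl => ? /andP[]; have := pk' s; lra.
Qed.

(** The form is a combination of squares with the coefficients [lam i]. *)
Lemma psd_rank1_sum (I : Type) (r : seq I) (P : pred I) (lam : I -> R)
    (phi : I -> Omega -> R) : (forall i, P i -> 0 <= lam i) ->
  psd (fun x y => \sum_(i <- r | P i) lam i * phi i x * phi i y).
Proof.
move=> lam0 s.
rewrite (_ : \sum_(v <- s) _ =
    \sum_(i <- r | P i) lam i * (\sum_(v <- s) v.1 * phi i v.2) ^+ 2).
  by apply: sumr_ge0 => i Pi; rewrite mulr_ge0// ?lam0// sqr_ge0.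
under eq_bigr => v _ do under eq_bigr => w _ do rewrite mulr_sumr.
under eq_bigr => v _ do rewrite exchange_big.
rewrite exchange_big; apply: eq_bigr => i Pi /=.
rewrite expr2 mulr_suml mulr_sumr; apply: eq_bigr => v _.
rewrite mulr_sumr mulr_sumr; apply: eq_bigr => w _; ring.
Qed.

Lemma mercer_expansion_psd (mu : probability (borel Omega) R)
    (K : Omega * Omega -> R) :
  mercer_expansion mu K -> psd (fun x y => K (x, y)).
Proof.
move=> [lam [phi [lam0 /uniform_cvgnP unif _]]]; apply: psd_approx => e e0.
have [n _ Hn] := unif _ e0.
exists (fun x y => \sum_(0 <= j < n | (j%:R%:E < L2_dim mu)%E)
  lam j * phi j x * phi j y); first exact: (psd_rank1_sum _ _ lam0).
by move=> x y; exact: (Hn n (leqnn n) (x, y)).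
Qed.

(** The form is the integral over [z] of the square of the sum of
    [v.1 * k (v.2, z)]. *)
Lemma factorization_psd (mu : probability (borel Omega) R)
    (K : Omega * Omega -> R) :
  symmetric_L2_factorization mu K -> psd (fun x y => K (x, y)).
Proof.
move=> [k [_ sk ik Kk]] s.
have Rsum (F : R * Omega -> borel Omega -> R) :
    (forall w, mu.-integrable setT (EFin \o F w)) ->
    \sum_(w <- s) \int[mu]_z F w z = \int[mu]_z (\sum_(w <- s) F w z).
  move=> iF; rewrite /Rintegral.
  under [in RHS]eq_integral => z _ do rewrite -sumEFin.
  rewrite (integral_sum measurableT iF).
  elim: s => [|w s' ih]; first by rewrite !big_nil.
  rewrite !big_cons ih [RHS]fineD//; first exact: (integrable_fin_num measurableT (iF _)).
  by apply/sum_fin_numP => v _ _; exact: (integrable_fin_num measurableT (iF _)).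
have iZ c v w : mu.-integrable setT (fun z => (c * (k (v, z) * k (z, w)))%:E).
  rewrite (_ : (fun z => _) = (fun z => c%:E * (k (v, z) * k (z, w))%:E)%E).
    exact: integrableZl.
  by apply/funext => z; rewrite EFinM.
rewrite (_ : \sum_(v <- s) _ = \int[mu]_z (\sum_(v <- s) v.1 * k (v.2, z)) ^+ 2).
  by apply: Rintegral_ge0 => z _; exact: sqr_ge0.
transitivity (\int[mu]_z (\sum_(v <- s) \sum_(w <- s)
    v.1 * w.1 * (k (v.2, z) * k (z, w.2)))).
  rewrite -Rsum; last first.
    move=> v; rewrite /comp; under eq_fun do rewrite -sumEFin.
    by apply: integrable_sum => // w _; exact: iZ.
  apply: eq_bigr => v _; rewrite -Rsum; last by move=> w; exact: iZ.
  by apply: eq_bigr => w _; rewrite Kk RintegralZl//; exact: ik.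
apply: eq_Rintegral => z _; rewrite expr2 mulr_suml; apply: eq_bigr => v _.
rewrite mulr_sumr; apply: eq_bigr => w _; rewrite [k (z, _)]sk; ring.
Qed.

(** If [k x y] is viewed as the scalar product of vectors attached to [x] and [y],
    this is the squared distance of these vectors. *)
Definition kdist k x y := k x x + k y y - 2 * k x y.

Section psd_theory.
Variable k : Omega -> Omega -> R.
Hypothesis pk : psd k.
Hypothesis sk : symk k.

Lemma psd_diag x : 0 <= k x x.
Proof. by have := pk [:: (1, x)]; rewrite !big_seq1 !mul1r. Qed.

Lemma psd2 a b x y : 0 <= a ^+ 2 * k x x + 2 * a * b * k x y + b ^+ 2 * k y y.
Proof.
have := pk [:: (a, x); (b, y)]; rewrite !big_cons !big_nil /= (sk y x).
by lra.
Qed.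

Lemma kdist_ge0 x y : 0 <= kdist k x y.
Proof. by have := psd2 1 (-1) x y; rewrite /kdist; lra. Qed.

Lemma psd_le_max x y M : k x x <= M -> k y y <= M -> `|k x y| <= M.
Proof.
move=> xM yM; have := psd2 1 (-1) x y; have := psd2 1 1 x y.
by rewrite ler_norml => ? ?; apply/andP; split; lra.
Qed.

End psd_theory.

(** The Gram kernel of the projections orthogonal to the vector of [p]; when
    [k p p = 0] the quotient is zero and this is [k] itself. *)
Definition schur k p x y := k x y - k x p * k p y / k p p.

(** The form of the Schur complement at a list is the form of [k] at the same list
    with the point [p] added, with the weight [- t] that minimizes it. *)
Lemma psd_schur k p : symk k -> psd k -> psd (schur k p).
Proof.
move=> sk pk s; have [k0|k0] := eqVneq (k p p) 0.
  rewrite /schur k0 invr0; under eq_bigr do under eq_bigr do rewrite mulr0 subr0.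
  exact: pk.
pose t := (\sum_(v <- s) v.1 * k v.2 p) / k p p.
have := pk ((- t, p) :: s); rewrite !big_cons /=.
under [X in _ + X]eq_bigr do rewrite big_cons /=.
rewrite big_split/= /schur.
have E1 : \sum_(w <- s) - t * w.1 * k p w.2 = - (t ^+ 2 * k p p).
  rewrite (eq_bigr (fun w => - t * (w.1 * k w.2 p))); last first.
    by move=> w _; rewrite (sk p) mulrA.
  by rewrite -mulr_sumr /t; field.
have E2 : \sum_(v <- s) v.1 * - t * k v.2 p = - (t ^+ 2 * k p p).
  rewrite (eq_bigr (fun w => - t * (w.1 * k w.2 p))); last by move=> w _; ring.
  by rewrite -mulr_sumr /t; field.
have E3 : \sum_(v <- s) \sum_(w <- s) v.1 * w.1 *
    (k v.2 w.2 - k v.2 p * k p w.2 / k p p) =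
    \sum_(v <- s) \sum_(w <- s) v.1 * w.1 * k v.2 w.2 - t ^+ 2 * k p p.
  rewrite [X in _ - X](_ : _ = \sum_(v <- s) \sum_(w <- s)
      v.1 * w.1 * (k v.2 p * k p w.2 / k p p)).
    rewrite -sumrB; apply: eq_bigr => v _; rewrite -sumrB.
    by apply: eq_bigr => w _; ring.
  have -> : t ^+ 2 * k p p = (\sum_(v <- s) v.1 * k v.2 p) *
      (\sum_(v <- s) v.1 * k v.2 p) / k p p by rewrite /t; field.
  rewrite !mulr_suml; apply: eq_bigr => v _.
  rewrite mulr_sumr mulr_suml; apply: eq_bigr => w _; rewrite (sk p); ring.
by rewrite E1 E2 E3; lra.
Qed.

(** Orthogonal projections do not increase distances. *)
Lemma kdist_schur k p x y : symk k -> psd k ->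
  kdist (schur k p) x y <= kdist k x y.
Proof.
move=> sk pk; rewrite -subr_ge0.
rewrite (_ : _ - _ = (k x p - k y p) ^+ 2 / k p p).
  by rewrite divr_ge0 ?sqr_ge0// psd_diag.
by rewrite /kdist /schur (sk p x) (sk p y); ring.
Qed.

Lemma schur_diag k p x : symk k -> psd k -> schur k p x x <= k x x.
Proof.
move=> sk pk; rewrite /schur gerBl (sk p) -expr2.
by rewrite divr_ge0 ?sqr_ge0// psd_diag.
Qed.

Lemma schur_pivot k p x : k p p != 0 -> schur k p p x = 0.
Proof. by move=> k0; rewrite /schur mulrAC divff// mul1r subrr. Qed.

Lemma schur_null k p q : (forall x, k q x = 0) -> forall x, schur k p q x = 0.
Proof. by move=> kq x; rewrite /schur !kq mul0r mul0r subrr. Qed.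

Hypothesis cptO : compact [set: Omega].

Lemma ukernel_schur k p : ukernel k -> ukernel (schur k p).
Proof.
move=> uk; split; first by move=> x y; rewrite /schur (uk.1 x y) (uk.1 x p) (uk.1 p y); ring.
move=> e e0; have [_ [M kM]] := ukernel_bmeas cptO p uk.
have M0 : 0 <= M by exact: le_trans (kM point).
pose c := 1 + M / `|k p p|; have c0 : 0 < c by rewrite ltr_pwDl// divr_ge0.
have [del d0 H] := uk.2 _ (divr_gt0 e0 c0); exists del => // x y xy z.
rewrite /schur (_ : _ - _ = (k x z - k y z) - (k x p - k y p) * (k p z / k p p)); last by ring.
have eE : e = e / c + e / c * (M / `|k p p|).
  by rewrite -[X in X + _]mulr1 -mulrDr -/c divfK// gt_eqF.
rewrite (le_trans (ler_normB _ _))// [leRHS]eE lerD ?H// !normrM ler_pM// ?H//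
  normfV ler_wpM2r ?invr_ge0//.
by rewrite uk.1.
Qed.

Lemma ukernel_max k : ukernel k -> exists p, forall x, k x x <= k p p.
Proof.
move=> uk; have cd : continuous (fun x => k x x).
  move=> x; apply/cvgrPdist_le => e e0; have e20 : 0 < e / 2 by rewrite divr_gt0.
  have [del d0 H] := uk.2 _ e20; apply/nbhs_ballP; exists del => // y xy.
  rewrite -(subrKA (k x y)) (le_trans (ler_normD _ _))// [leRHS]splitr lerD ?H//.
  by rewrite (uk.1 x) H.
have [||p _ H] := compact_EVT_max (f := fun x => k x x) _ cptO.
- by exists point.
- exact: continuous_subspaceT.
- by exists p => x; apply: H; exact: in_setT.
Qed.

End psd_kernels.

(** * The pivoted Cholesky expansion *)

Lemma Lfun2_bmeas {d} {T : measurableType d} {R : realType}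
    (m : {finite_measure set T -> \bar R}) (f : T -> R) :
  bmeas f -> f \in Lfun m 2%:E.
Proof.
move=> bf; have [mf _] := bf; rewrite inE; apply/andP; split; rewrite inE//=.
rewrite /finite_norm unlock; apply: poweR_lty.
have [_ ] := integrableP _ _ _ (bmeas_integrable m (bmeasM bf bf)).
apply: le_lt_trans; rewrite le_eqVlt; apply/orP; left; apply/eqP.
by apply: eq_integral => x _ /=; rewrite normrM -expr2 -powR_mulrn.
Qed.

Lemma ae_witness {d} {T : measurableType d} {R : realType}
    (m : {measure set T -> \bar R}) (P : T -> Prop) (B : set T) :
  measurable B -> (0 < m B)%E -> {ae m, forall x, P x} -> exists2 x, B x & P x.
Proof.
move=> mB B0 [N [mN N0 PN]]; apply: contrapT => H; move: B0.
suff : (m B <= m N)%E by rewrite N0 leNgt => /negbTE ->.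
apply: le_measure; rewrite ?inE// => x Bx; apply: PN => Px.
by apply: H; exists x.
Qed.

Section cholesky.
Context {R : realType} {Omega : pmetricType R}.
Implicit Types (k : Omega -> Omega -> R) (x y : Omega).

(** Indicators of disjoint sets of positive measure are independent: each set
    contains a point where a given null combination does vanish. *)
Lemma L2_dim_ge (mu : probability (borel Omega) R) (n : nat)
    (B : 'I_n -> set (borel Omega)) :
  (forall i, measurable (B i)) -> (forall i, (0 < mu (B i))%E) ->
  (forall i j, i != j -> B i `&` B j = set0) -> ((n%:R)%:E <= L2_dim mu)%E.
Proof.
move=> mB B0 dB; apply: ereal_sup_ubound; exists n => //.
exists (fun i => \1_(B i)); split=> [i|c cB i].
  by apply: Lfun2_bmeas; exact: bmeas_indic.
have [x Bx] := ae_witness (mB i) (B0 i) cB.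
rewrite (bigD1 i)//= big1 ?addr0 => [|j ji].
  by rewrite indicE mem_set// mulr1.
rewrite indicE memNset ?mulr0// => Bjx.
by have := dB j i ji; rewrite -subset0 => /(_ x); apply.
Qed.

(** A maximum of the diagonal; the default [point] is not reached for a uniform
    kernel on a compact space. *)
Definition pivot k := xget point [set p | forall x, k x x <= k p p].

Definition residual k n := iter n (fun r => schur r (pivot r)) k.

Variable k : Omega -> Omega -> R.
Hypothesis cptO : compact [set: Omega].
Hypothesis uk : ukernel k.
Hypothesis pk : psd k.

Let r n := residual k n.
Let q n := pivot (r n).
Let v n := r n (q n) (q n).

Lemma residualS n x y : r n.+1 x y = r n x y - r n x (q n) * r n (q n) y / v n.
Proof. by []. Qed.

Lemma residual_ok n : ukernel (r n) /\ psd (r n).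
Proof.
elim: n => [//|n [un pn]]; split; first exact: ukernel_schur.
by apply: psd_schur => //; exact: un.1.
Qed.

Let ru n : ukernel (r n). Proof. by have [] := residual_ok n. Qed.
Let rp n : psd (r n). Proof. by have [] := residual_ok n. Qed.
Let rs n : symk (r n). Proof. exact: (ru n).1. Qed.

Lemma pivot_max n x : r n x x <= v n.
Proof.
have [p pmax] := ukernel_max cptO (ru n).
by move: x; apply: (@xgetPex _ point [set p | forall x, r n x x <= r n p p]); exists p.
Qed.

Lemma pivot_ge0 n : 0 <= v n. Proof. exact: psd_diag. Qed.

Lemma residual_le n x y : `|r n x y| <= v n.
Proof. by apply: (psd_le_max (rp n) (rs n)); exact: pivot_max. Qed.

Lemma pivot_nincr : {homo v : m n / (m <= n)%N >-> n <= m}.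
Proof.
apply: homo_leq; [by move=> ?; exact: lexx|by move=> a b c; exact: ge_trans|].
move=> n; apply: le_trans (pivot_max n (q n.+1)).
exact: schur_diag.
Qed.

(** Each elimination step kills the row of its pivot, and later steps keep it
    zero.  A pivot with zero diagonal is also covered: all residuals then
    vanish. *)
Lemma residual_pivot m n x : (m < n)%N -> r n (q m) x = 0.
Proof.
move=> mn; rewrite -(subnKC mn); elim: (n - m.+1)%N x => [|i ih] x; last first.
  rewrite addnS; exact: (schur_null _ ih x).
rewrite addn0; have [v0|v0] := eqVneq (v m) 0; last exact: (schur_pivot x v0).
have : `|r m.+1 (q m) x| <= v m.
  by rewrite (le_trans (residual_le _ _ _))// pivot_nincr.
by rewrite v0 normr_le0 => /eqP.
Qed.

Lemma residual_kdist n x y : kdist (r n) x y <= kdist k x y.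
Proof.
by elim: n => [//|n ih]; apply: le_trans ih; exact: kdist_schur.
Qed.

(** At step [n] the vector of [q m] is already projected to zero, so [v n] is the
    squared distance between the projected vectors. *)
Lemma pivot_le_kdist m n : (m < n)%N -> v n <= kdist k (q m) (q n).
Proof.
move=> mn; apply: le_trans (residual_kdist n (q m) (q n)).
by rewrite /kdist !(residual_pivot _ mn) mulr0 subr0 add0r.
Qed.

Lemma pivot_separated (e : R) : 0 < e -> exists2 del, 0 < del &
  forall m n, (m < n)%N -> e < v n -> ~ ball (q m) del (q n).
Proof.
move=> e0; have e20 : 0 < e / 2 by rewrite divr_gt0.
have [del d0 H] := uk.2 _ e20; exists del => // m n mn en qq.
have := pivot_le_kdist mn; have := H _ _ qq (q m); have := H _ _ qq (q n).
rewrite !ler_norml /kdist (uk.1 (q n) (q m)) => /andP[? ?] /andP[? ?] ?.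
lra.
Qed.

(** Otherwise infinitely many pivots are separated by a fixed distance; two of any
    [N.+1] of them lie in the same cell of a partition into [N] small cells. *)
Lemma pivot_cvg0 (e : R) : 0 < e -> exists N, forall n, (N <= n)%N -> v n <= e.
Proof.
move=> e0; have [del d0 sep] := pivot_separated e0.
have d20 : 0 < del / 2 by rewrite divr_gt0.
have [N [p [idx [_ pb]]]] := small_partition cptO d20.
suff [n vn] : exists n, v n <= e.
  by exists n => i ni; rewrite (le_trans (pivot_nincr ni)).
apply: contrapT => /forallNP H.
have inj : injective (fun i : 'I_N.+1 => idx (q i)).
  suff W (i j : 'I_N.+1) : (i < j)%N -> idx (q i) <> idx (q j).
    move=> i j /= ij; case: (ltngtP i j) => [lij|lij|/val_inj//].
      by case: (W _ _ lij ij).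
    by case: (W _ _ lij (esym ij)).
  move=> lij ij; apply: (sep _ _ lij); first by rewrite ltNge; exact/negP.
  rewrite (splitr del); apply: (@ball_triangle _ _ (p (idx (q i)))).
    by apply: ball_sym; exact: pb.
  by rewrite ij; exact: pb.
by have := leq_card _ inj; rewrite !card_ord ltnn.
Qed.

(** As the pivot values decrease, the first [n.+1] pivots are all separated, so the
    balls of half the separating radius around them are disjoint. *)
Lemma pivot_dim (mu : probability (borel Omega) R) n :
  measure_support mu = [set: Omega] -> 0 < v n -> ((n%:R)%:E < L2_dim mu)%E.
Proof.
move=> full vn0; have e0 : 0 < v n / 2 by rewrite divr_gt0.
have [del d0 sep] := pivot_separated e0.
have d20 : 0 < del / 2 by rewrite divr_gt0.
apply: (@lt_le_trans _ _ (n.+1%:R)%:E); first by rewrite lte_fin ltr_nat.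
apply: (@L2_dim_ge mu n.+1 (fun i => (ball (q i) (del / 2))°)).
- by move=> i; apply: open_measurable_borel; exact: open_interior.
- by move=> i; exact: ball_gt0.
suff W (i j : 'I_n.+1) : (i < j)%N ->
    (ball (q i) (del / 2))° `&` (ball (q j) (del / 2))° = set0.
  move=> i j; rewrite -val_eqE neq_ltn => /orP[/W//|/W]; by rewrite setIC.
move=> ij; rewrite -subset0 => x [/interior_subset xi /interior_subset xj].
apply: (sep _ _ ij).
  apply: lt_le_trans (pivot_nincr (ltn_ord j : (j <= n)%N)).
  by rewrite ltr_pdivrMr// mulr_natr mulr2n ltrDl.
by rewrite (splitr del); apply: ball_triangle xi _; exact: ball_sym.
Qed.

(** The [n]-th term is the difference of two consecutive residuals, so the partial
    sums telescope.  A term whose index reaches the dimension is zero by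
    [pivot_dim]. *)
Lemma psd_mercer (mu : probability (borel Omega) R) (K : Omega * Omega -> R) :
  measure_support mu = [set: Omega] -> (forall x y, K (x, y) = k x y) ->
  mercer_expansion mu K.
Proof.
move=> full Kk; pose phi n x := r n x (q n) / Num.sqrt (v n).
have phiE n x y : phi n x * phi n y = r n x y - r n.+1 x y.
  rewrite residualS opprB addrC subrK /phi mulrACA (rs n y) -invfM.
  by rewrite -expr2 sqr_sqrtr// pivot_ge0.
have dimE n x y : ~~ ((n%:R)%:E < L2_dim mu)%E -> 1 * phi n x * phi n y = 0.
  apply: contraNeq; rewrite mul1r => phi0; apply: pivot_dim => //.
  rewrite lt_def pivot_ge0 andbT; apply: contra_neq phi0 => v0.
  by rewrite /phi v0 sqrtr0 invr0 !mulr0.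
have sumE n x y : \sum_(0 <= j < n | ((j%:R)%:E < L2_dim mu)%E)
    1 * phi j x * phi j y = k x y - r n x y.
  rewrite big_mkcond; under eq_bigr => j _.
    rewrite (_ : (if _ then _ else _) = r j x y - r j.+1 x y); last first.
      by rewrite -phiE; case: ifPn => [|/(dimE _ x y)]; rewrite mul1r.
    over.
  elim: n => [|n ih]; first by rewrite big_nil subrr.
  by rewrite big_nat_recr//= ih addrA subrK.
exists (fun _ => 1), phi; split=> [//||x y].
  apply/uniform_cvgnP => e e0; have [N HN] := pivot_cvg0 e0.
  exists N => // n /= Nn [x y] /=; rewrite Kk sumE opprB addrC subrK.
  by rewrite (le_trans (residual_le _ _ _))// HN.
(* Absolute convergence: [2 * `|a * b| <= a ^+ 2 + b ^+ 2], and on the diagonal the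
   partial sums are bounded by the kernel. *)
apply: nondecreasing_is_cvgn.
  apply/nondecreasing_seqP => n; rewrite [leRHS]big_mkcond big_nat_recr//=.
  by rewrite -big_mkcond lerDl; case: ifP.
exists (k x x + k y y) => _ [n _ <-].
apply: (@le_trans _ _ (\sum_(0 <= j < n | ((j%:R)%:E < L2_dim mu)%E)
    1 * phi j x * phi j x + \sum_(0 <= j < n | ((j%:R)%:E < L2_dim mu)%E)
    1 * phi j y * phi j y)).
  rewrite -big_split; apply: ler_sum => j _ /=; rewrite !mul1r ler_norml.
  have := sqr_ge0 (phi j x + phi j y); have := sqr_ge0 (phi j x - phi j y).
  by have := sqr_ge0 (phi j x); have := sqr_ge0 (phi j y); move=> *; apply/andP; split; lra.
rewrite !sumE; have := psd_diag (rp n) x; have := psd_diag (rp n) y; lra.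
Qed.

End cholesky.

(** * Polynomial certificates for the square root *)

Section square_root_polynomials.
Context {R : realType}.
Implicit Types p q : {poly R}.

(** The quadratic module of [X] and [1 - X]: certificates of nonnegativity on
    [0, 1] that remain valid for a symmetric operator [T] with [0 <= T <= 1]. *)
Inductive cone : {poly R} -> Prop :=
| cone_sqr q : cone (q ^+ 2)
| cone_Xsqr q : cone ('X * q ^+ 2)
| cone_1Xsqr q : cone ((1 - 'X) * q ^+ 2)
| coneD p q : cone p -> cone q -> cone (p + q).

(** The only product that is not immediate is that of [X] and [1 - X], which is
    [X ^+ 2 * (1 - X) + (1 - X) ^+ 2 * X]. *)
Lemma coneM p q : cone p -> cone q -> cone (p * q).
Proof.
move=> cp; elim: cp q => {p} [p|p|p|p1 p2 _ ih1 _ ih2] q cq; last first.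
- by rewrite mulrDl; apply: coneD; [exact: ih1|exact: ih2].
- elim: cq => {q} [q|q|q|q1 q2 _ ih1 _ ih2]; last by rewrite mulrDr; exact: coneD.
  + rewrite [X in cone X](_ : _ = (1 - 'X) * (p * q) ^+ 2); [exact: cone_1Xsqr|ring].
  + rewrite [X in cone X](_ : _ = (1 - 'X) * ('X * p * q) ^+ 2 +
                         'X * ((1 - 'X) * p * q) ^+ 2); last by ring.
    by apply: coneD; [exact: cone_1Xsqr|exact: cone_Xsqr].
  + rewrite [X in cone X](_ : _ = ((1 - 'X) * p * q) ^+ 2); [exact: cone_sqr|ring].
- elim: cq => {q} [q|q|q|q1 q2 _ ih1 _ ih2]; last by rewrite mulrDr; exact: coneD.
  + rewrite [X in cone X](_ : _ = 'X * (p * q) ^+ 2); [exact: cone_Xsqr|ring].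
  + rewrite [X in cone X](_ : _ = ('X * p * q) ^+ 2); [exact: cone_sqr|ring].
  + rewrite [X in cone X](_ : _ = (1 - 'X) * ('X * p * q) ^+ 2 +
                         'X * ((1 - 'X) * p * q) ^+ 2); last by ring.
    by apply: coneD; [exact: cone_1Xsqr|exact: cone_Xsqr].
- elim: cq => {q} [q|q|q|q1 q2 _ ih1 _ ih2]; last by rewrite mulrDr; exact: coneD.
  + rewrite [X in cone X](_ : _ = (p * q) ^+ 2); [exact: cone_sqr|ring].
  + rewrite [X in cone X](_ : _ = 'X * (p * q) ^+ 2); [exact: cone_Xsqr|ring].
  + rewrite [X in cone X](_ : _ = (1 - 'X) * (p * q) ^+ 2); [exact: cone_1Xsqr|ring].
Qed.

Lemma coneC (c : R) : 0 <= c -> cone c%:P.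
Proof. by move=> c0; rewrite -(sqr_sqrtr c0) polyC_exp; exact: cone_sqr. Qed.

Lemma cone1 : cone 1. Proof. by rewrite -(expr1n _ 2); exact: cone_sqr. Qed.

Lemma cone0 : cone 0.
Proof. by have := cone_sqr 0; rewrite expr0n. Qed.

Lemma coneX : cone 'X.
Proof. by rewrite -['X]mulr1 -(expr1n _ 2); exact: cone_Xsqr. Qed.

Lemma cone1X : cone (1 - 'X).
Proof. by have := cone_1Xsqr 1; rewrite expr1n mulr1. Qed.

Let h : {poly R} := (2^-1)%:P.

Let hh : h + h = 1.
Proof.
by rewrite /h -polyCD -mulr2n -[_ *+ 2]mulr_natr mulVf ?pnatr_eq0// polyC1.
Qed.

Let ch : cone h. Proof. by apply: coneC; rewrite invr_ge0. Qed.

(** The approximate square roots [y_n] of [X] are [X * sqrt_quot n]; keeping the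
    quotient makes visible that [y_n (T)] is a multiple of [T], hence has a
    kernel. *)
Fixpoint sqrt_quot n : {poly R} :=
  if n is n'.+1 then sqrt_quot n' + h * (1 - 'X * sqrt_quot n' ^+ 2) else 0.

Lemma sqrt_quotS n :
  sqrt_quot n.+1 = sqrt_quot n + h * (1 - 'X * sqrt_quot n ^+ 2).
Proof. by []. Qed.

Let s := sqrt_quot.
Let y n : {poly R} := 'X * s n.
Let z n : {poly R} := 1 - y n.
Let r n : {poly R} := 'X - y n ^+ 2.

Let yS n : y n.+1 = y n + h * r n.
Proof.
rewrite /r /y /s sqrt_quotS; ring.
Qed.

Let zS n : z n.+1 = h * ((1 - 'X) + z n ^+ 2).
Proof.
apply/eqP; rewrite -subr_eq0 /z yS /r; apply/eqP.
by transitivity ((1 - (h + h)) * (1 - y n)); [ring|rewrite hh subrr mul0r].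
Qed.

Let rS n : r n.+1 = r n * (h * (z n + z n.+1)).
Proof.
apply/eqP; rewrite -subr_eq0 /z /r !yS /r; apply/eqP.
transitivity ((1 - (h + h)) * ('X - y n ^+ 2)); last by rewrite hh subrr mul0r.
by ring.
Qed.

Lemma cone_compl n : cone (1 - y n).
Proof.
elim: n => [|n ih]; first by rewrite /y /s /= mulr0 subr0; exact: cone1.
rewrite -/(z n.+1) zS; apply: coneM => //; apply: coneD; first exact: cone1X.
exact: cone_sqr.
Qed.

Lemma cone_residual n : cone (r n).
Proof.
elim: n => [|n ih]; first by rewrite /r /y /s /= mulr0 expr0n subr0; exact: coneX.
rewrite rS; apply: coneM => //; apply: coneM => //.
by apply: coneD; exact: cone_compl.
Qed.

Lemma cone_sqrt_incr m n : (m <= n)%N -> cone (y n - y m).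
Proof.
move=> /subnKC <-; elim: (n - m)%N => [|i ih].
  by rewrite addn0 subrr; exact: cone0.
rewrite addnS yS addrAC; apply: coneD => //.
by apply: coneM => //; exact: cone_residual.
Qed.

Lemma cone_sqrt n : cone (y n).
Proof. by have := cone_sqrt_incr (leq0n n); rewrite {2}/y /s /= mulr0 subr0. Qed.

(** With [y n] and [r n] as above the polynomial is
    [r n + 2 * y m * (y n - y m)]. *)
Lemma cone_sqrt_cauchy m n : (m <= n)%N ->
  cone ('X * (1 - 'X * s m ^+ 2 - 'X * (s n - s m) ^+ 2)).
Proof.
move=> mn; rewrite [X in cone X](_ : _ = r n + (y m * (y n - y m) + y m * (y n - y m))).
  apply: coneD; first exact: cone_residual.
  by apply: coneD; (apply: coneM; [exact: cone_sqrt|exact: cone_sqrt_incr]).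
by rewrite /r /y; ring.
Qed.

(** The residuals [r i] decrease and the sum of the first [n] of them is [2 * y n],
    which is at most [2]. *)
Lemma cone_residual_rate n : cone (2%:R - n%:R * ('X * (1 - 'X * s n ^+ 2))).
Proof.
have -> : 'X * (1 - 'X * s n ^+ 2) = r n by rewrite /r /y; ring.
suff cn : cone ((y n + y n) - n%:R * r n).
  rewrite [X in cone X](_ : _ = z n + z n + ((y n + y n) - n%:R * r n)).
    by apply: coneD => //; apply: coneD; exact: cone_compl.
  by rewrite /z; ring.
elim: n => [|n ih]; first by rewrite /y /s /= mulr0 mul0r subr0 addr0; exact: cone0.
rewrite [X in cone X](_ : _ = (y n + y n - n%:R * r n) + n.+1%:R * (r n - r n.+1)).
  apply: coneD => //; apply: coneM.
    by rewrite -polyC_natr; apply: coneC; exact: ler0n.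
  rewrite rS [X in cone X](_ : _ = r n * (h * (y n + y n.+1))).
    apply: coneM; first exact: cone_residual.
    by apply: coneM => //; apply: coneD; exact: cone_sqrt.
  apply/eqP; rewrite -subr_eq0 /z; apply/eqP.
  transitivity ((1 - (h + h)) * r n); last by rewrite hh subrr mul0r.
  by ring.
apply/eqP; rewrite -subr_eq0 yS -addn1 natrD; apply/eqP.
transitivity ((h + h - 1) * r n); last by rewrite hh subrr mul0r.
by ring.
Qed.

Lemma cone_square_le n : cone ('X * ('X * s n ^+ 2)).
Proof. by rewrite mulrA -expr2 -exprMn; exact: cone_sqr. Qed.

Lemma cone_residualE n : cone ('X * (1 - 'X * s n ^+ 2)).
Proof.
rewrite [X in cone X](_ : _ = r n); first exact: cone_residual.
by rewrite /r /y; ring.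
Qed.

End square_root_polynomials.

Section moments.
Context {R : realType}.
Implicit Types (p q : {poly R}) (M : nat -> R).

(** The polynomial [p] with [X ^+ i] replaced by [M i].  With [M i] the value of
    [T ^+ i] at a function, at a point or in a quadratic form, this is the
    corresponding value of [p (T)]. *)
Definition mom M p := \sum_(i < size p) p`_i * M i.

Lemma mom_widen M p N : (size p <= N)%N -> mom M p = \sum_(i < N) p`_i * M i.
Proof.
move=> pN; rewrite /mom (big_ord_widen _ (fun i => p`_i * M i) pN) big_mkcond.
apply: eq_bigr => i _; case: ltnP => // pi.
by rewrite nth_default// mul0r.
Qed.

Lemma mom0 M : mom M 0 = 0.
Proof. by rewrite /mom size_poly0 big_ord0. Qed.

Lemma momD M p q : mom M (p + q) = mom M p + mom M q.
Proof.
pose N := maxn (size p) (size q).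
rewrite (@mom_widen M _ N); last exact: size_polyD.
rewrite (@mom_widen M p N) ?leq_maxl// (@mom_widen M q N) ?leq_maxr// -big_split.
by apply: eq_bigr => i _; rewrite coefD mulrDl.
Qed.

Lemma momZ M (c : R) p : mom M (c *: p) = c * mom M p.
Proof.
rewrite (@mom_widen M _ (size p)) ?size_scale_leq// mulr_sumr.
by apply: eq_bigr => i _; rewrite coefZ mulrA.
Qed.

Lemma momB M p q : mom M (p - q) = mom M p - mom M q.
Proof. by rewrite momD -scaleN1r momZ mulN1r. Qed.

Lemma mom_sum M (I : Type) (l : seq I) (F : I -> {poly R}) :
  mom M (\sum_(i <- l) F i) = \sum_(i <- l) mom M (F i).
Proof. by apply: big_morph; [move=> p q; exact: momD|exact: mom0]. Qed.

Lemma momXn M n : mom M 'X^n = M n.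
Proof.
rewrite /mom size_polyXn big_ord_recr/= coefXn eqxx mul1r big1 ?add0r// => i _.
by rewrite coefXn ltn_eqF// mul0r.
Qed.

Lemma mom1 M : mom M 1 = M 0%N.
Proof. by rewrite -(expr0 'X) momXn. Qed.

Lemma momM M p q : mom M (p * q) =
  \sum_(i < size p) \sum_(j < size q) p`_i * q`_j * M (i + j)%N.
Proof.
rewrite -{1}(coefK p) poly_def mulr_suml mom_sum; apply: eq_bigr => i _.
rewrite -{1}(coefK q) poly_def mulr_sumr mom_sum; apply: eq_bigr => j _.
by rewrite -scalerAl -scalerAr -exprD !momZ momXn mulrA.
Qed.

Lemma momXM M p : mom M ('X * p) = mom (fun i => M i.+1) p.
Proof.
rewrite momM size_polyX big_ord_recl big_ord1/= /mom.
under eq_bigr do rewrite coefX/= !mul0r.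
rewrite big1// add0r; apply: eq_bigr => j _.
by rewrite coefX/= mul1r.
Qed.

End moments.

(** * The integral operator of a kernel and polynomials in it *)

Section kernel_operator.
Context {R : realType} {Omega : pmetricType R}.
Variables (mu : probability (borel Omega) R) (k : Omega -> Omega -> R).
Hypothesis cptO : compact [set: Omega].
Hypothesis full : measure_support mu = [set: Omega].
Hypothesis uk : ukernel k.
Hypothesis pk : psd k.
Hypothesis k_le1 : forall x y, `|k x y| <= 1.
Implicit Types (f g h : borel Omega -> R) (x y z : Omega) (p q : {poly R}).

Let D := density mu.

(** The integral operator [T] of the kernel [k]. *)
Definition kop h : borel Omega -> R := fun x => D h (fun z => k z x).

Let T i h := iter i kop h.

Let bk y : bmeas (fun z : borel Omega => k z y).
Proof. exact: ukernel_bmeas. Qed.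

Lemma densityC f g : D f g = D g f.
Proof. by apply: eq_Rintegral => z _; rewrite mulrC. Qed.

Lemma bmeas_kop h : bmeas h -> bmeas (kop h).
Proof.
move=> bh; have [C bD] := bfunctional_density mu bh.
by apply: ucont_bmeas => //; exact: potential_ucont bD.
Qed.

Lemma bmeas_kop_iter i h : bmeas h -> bmeas (T i h).
Proof. by move=> bh; elim: i => //= i ih; exact: bmeas_kop. Qed.

Lemma bienergy_kop f h : bienergy k (D f) (D h) = D h (kop f).
Proof. by []. Qed.

Lemma kop_sym f g : bmeas f -> bmeas g -> D g (kop f) = D f (kop g).
Proof.
move=> bf bg; have [C1 b1] := bfunctional_density mu bf.
have [C2 b2] := bfunctional_density mu bg.
exact: (bienergyC cptO uk b1 b2).
Qed.

Lemma kop_iter_sym i f g : bmeas f -> bmeas g -> D g (T i f) = D f (T i g).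
Proof.
move=> bf bg; elim: i f bf => [|i ih] f bf; first exact: densityC.
rewrite /T iterSr -/(T i _) ih; last exact: bmeas_kop.
by rewrite densityC kop_sym//; exact: bmeas_kop_iter.
Qed.

Lemma kop_iterD i j f g : bmeas f -> bmeas g ->
  D (T j g) (T i f) = D g (T (i + j) f).
Proof.
move=> bf bg; rewrite densityC -kop_iter_sym//; last exact: bmeas_kop_iter.
by rewrite /T addnC iterD.
Qed.

Lemma D_mom (u : nat -> borel Omega -> R) h p : bmeas h ->
  (forall i, bmeas (u i)) ->
  D h (fun x : borel Omega => mom (fun i => u i x) p) = mom (fun i => D h (u i)) p.
Proof.
move=> bh bu; have [C bD] := bfunctional_density mu bh.
exact: (@bf_sum _ _ _ _ _ bD _ _ _ (fun i : 'I_(size p) => p`_i) (fun i => u i)).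
Qed.

Lemma bmeas_mom (u : nat -> borel Omega -> R) p :
  (forall i, bmeas (u i)) -> bmeas (fun x : borel Omega => mom (fun i => u i x) p).
Proof. by move=> bu; apply: bmeas_sum => i; exact: bmeasZ. Qed.

(** If [a] is the integral of [`|g|], then [`|kop g| <= a] pointwise because
    [`|k| <= 1], so the left side is at most [a ^+ 2], and [a ^+ 2] is at most the
    integral of [g ^+ 2] since the variance of [`|g|] is nonnegative. *)
Lemma kop_contraction g : bmeas g -> D g (kop g) <= D g g.
Proof.
move=> bg; have bL := bfunctional_mu mu; set L := fun f => _ in bL.
have ba : bmeas (fun x : borel Omega => `|g x|).
  by have [mg [M gM]] := bg; split; [exact: measurableT_comp|exists M => x; rewrite normr_id].
have [_ [N gN]] := ba.
have bc (c : R) : bmeas (fun _ : borel Omega => c) by exact: bmeas_cst.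
pose a := L (fun x => `|g x|).
have a0 : 0 <= a by apply: Rintegral_ge0.
have Lle f f' : bmeas f -> bmeas f' -> (forall x, f x <= f' x) -> L f <= L f'.
  by move=> bf bf' ff'; apply: le_Rintegral => //; exact: bmeas_integrable.
have Tg x : `|kop g x| <= a.
  have bkg : bmeas (fun z : borel Omega => k z x * g z) by exact: bmeasM.
  rewrite (le_trans (le_normr_Rintegral measurableT (bmeas_integrable mu bkg)))//.
  apply: Lle => //.
    have [mkg [M kgM]] := bkg.
    by split; [exact: measurableT_comp|exists M => z; rewrite normr_id].
  by move=> z; rewrite normrM ler_piMl.
apply: (@le_trans _ _ (a * a)).
  rewrite -(bfZ bL)//; apply: Lle.
  - by apply: bmeasM => //; exact: bmeas_kop.
  - exact: bmeasZ.
  - by move=> x; rewrite (le_trans (ler_norm _))// normrM ler_wpM2r.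
have := Lle _ _ (bc 0) (bmeasM (bmeasB ba (bc a)) (bmeasB ba (bc a)))
  (fun x => sqr_ge0 _).
rewrite (bf0 bL).
have -> : L (fun x => (`|g x| - a) * (`|g x| - a)) =
    L (fun x => (- (2 * a)) * `|g x| + (1 * (g x * g x) + a * a)).
  congr L; apply/funext => x.
  transitivity (`|g x| ^+ 2 - 2 * a * `|g x| + a * a); first by ring.
  by rewrite real_normK ?num_real//; ring.
have bgg : bmeas (fun x : borel Omega => 1 * (g x * g x)) by apply: bmeasZ; exact: bmeasM.
rewrite (bf_lin bL)//; last by apply: bmeasD.
rewrite (bfD bL)// (bfZ bL); last exact: bmeasM.
have -> : L (fun=> a * a) = a * a.
  by rewrite /L Rintegral_cst// [X in fine X]probability_setT mulr1.
by rewrite -/a /D /density -/(L _) => H; lra.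
Qed.

Section moments_of_a_function.
Variable h : borel Omega -> R.
Hypothesis bh : bmeas h.

Let bT i : bmeas (T i h). Proof. exact: bmeas_kop_iter. Qed.

(** The quadratic form of [T ^+ i] at [h]. *)
Definition moment i := D h (T i h).

Let P q (x : borel Omega) := mom (fun i => T i h x) q.

Let bP q : bmeas (P q). Proof. exact: bmeas_mom. Qed.

Let kopP q x : kop (P q) x = mom (fun i => T i.+1 h x) q.
Proof.
rewrite /kop densityC D_mom//; apply: eq_bigr => i _; rewrite densityC//.
Qed.

Let momentM p q : D (P p) (P q) = mom moment (q * p).
Proof.
rewrite D_mom// momM; apply: eq_bigr => i _.
rewrite densityC D_mom// mulr_sumr; apply: eq_bigr => j _.
by rewrite mulrA densityC kop_iterD.
Qed.

Let momentXM p q : D (P p) (kop (P q)) = mom moment ('X * (q * p)).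
Proof.
rewrite (funext (kopP q)) D_mom// momXM momM; apply: eq_bigr => i _.
rewrite densityC D_mom// mulr_sumr; apply: eq_bigr => j _.
by rewrite mulrA densityC kop_iterD.
Qed.

(** For [g = q (T) h] the three kinds of generators give the scalar square of [g],
    the form of [T] at [g], and the difference of both. *)
Lemma moment_cone_ge0 p : cone p -> 0 <= mom moment p.
Proof.
elim=> {p} [q|q|q|p q _ p0 _ q0]; last by rewrite momD addr_ge0.
- by rewrite expr2 -momentM; apply: Rintegral_ge0 => x _; exact: sqr_ge0.
- rewrite expr2 -momentXM -bienergy_kop.
  by have [C bD] := bfunctional_density mu (bP q); exact: psd_bienergy bD.
- rewrite mulrBl mul1r momB expr2 -momentM -momentXM subr_ge0.
  exact: kop_contraction.
Qed.

End moments_of_a_function.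

(** The kernel of [T ^+ i.+1]. *)
Definition iter_kernel i x y := T i (fun z => k z y) x.

Lemma iter_kernelS i x y :
  iter_kernel i.+1 x y = D (fun z => k z x) (T i (fun z => k z y)).
Proof. by rewrite densityC. Qed.

Lemma iter_kernel_sym i : symk (iter_kernel i).
Proof.
case: i => [|i] x y; first exact: uk.1.
by rewrite !iter_kernelS kop_iter_sym.
Qed.

Lemma iter_kernel_le1 i x y : `|iter_kernel i x y| <= 1.
Proof.
have bL := bfunctional_mu mu.
elim: i x => [|i ih] x; first exact: k_le1.
rewrite iter_kernelS -[1 in leRHS]mulr1; apply: (bf_le bL).
  by apply: bmeasM => //; exact: bmeas_kop_iter.
by move=> z; rewrite normrM mulr_ile1//; exact: ih.
Qed.

(** All iterates share the modulus of continuity of [k], because they are bounded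
    by [1]. *)
Lemma iter_kernel_equicont (e del : R) :
  (forall x y, ball x del y -> forall z, `|k x z - k y z| <= e) ->
  forall i x y, ball x del y ->
    forall z, `|iter_kernel i x z - iter_kernel i y z| <= e.
Proof.
move=> H i x y xy z; case: i => [|i]; first exact: H.
have bi := bmeas_kop_iter i (bk z).
have bL := bfunctional_mu mu.
rewrite !iter_kernelS -[leRHS]mul1r; apply: (bf_dist bL); [exact: bmeasM..|].
move=> w; rewrite -mulrBr normrM -[leRHS]mul1r ler_pM//.
  exact: iter_kernel_le1.
by rewrite (uk.1 w x) (uk.1 w y) H.
Qed.

(** The kernel of the operator [T * q (T)]. *)
Definition poly_kernel q x y := mom (fun i => iter_kernel i x y) q.

Lemma ukernel_poly q : ukernel (poly_kernel q).
Proof.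
split; first by move=> x y; apply: eq_bigr => i _; rewrite iter_kernel_sym.
move=> e e0; have S1 : 0 < \sum_(i < size q) `|q`_i| + 1.
  by rewrite ltr_wpDl// sumr_ge0.
have [del d0 /iter_kernel_equicont H] := uk.2 _ (divr_gt0 e0 S1).
exists del => // x y xy z; rewrite /poly_kernel /mom -sumrB.
rewrite (le_trans (ler_norm_sum _ _ _))//.
apply: (@le_trans _ _ (\sum_(i < size q) `|q`_i| * (e / (\sum_(i < size q) `|q`_i| + 1)))).
  by apply: ler_sum => i _; rewrite -mulrBr normrM ler_wpM2l// H.
by rewrite -mulr_suml mulrCA ger_pMr// ler_pdivrMr// mul1r lerDl.
Qed.

Lemma poly_kernel1 x y : poly_kernel 1 x y = k x y.
Proof. exact: mom1. Qed.

Lemma poly_kernelB p q x y :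
  poly_kernel (p - q) x y = poly_kernel p x y - poly_kernel q x y.
Proof. exact: momB. Qed.

(** Composition of kernels is composition of operators, and
    [(X * p) * (X * q) = X * (X * (p * q))]. *)
Lemma poly_kernelM p q x y :
  \int[mu]_z (poly_kernel p x z * poly_kernel q z y) =
  poly_kernel ('X * (p * q)) x y.
Proof.
have sp : (fun z => poly_kernel p x z) = (fun z => poly_kernel p z x).
  by apply/funext => z; exact: (ukernel_poly p).1.
have bi i w : bmeas (fun z : borel Omega => iter_kernel i z w).
  exact: bmeas_kop_iter.
have bp w q' : bmeas (fun z : borel Omega => poly_kernel q' z w).
  exact: ukernel_bmeas (ukernel_poly q').
rewrite (_ : \int[mu]_z _ = D (poly_kernel p ^~ x) (poly_kernel q ^~ y)); last first.
  by apply: eq_Rintegral => z _; rewrite mulrC; congr (_ * _); exact: (congr1 (@^~ z) sp).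
rewrite densityC [RHS]/poly_kernel momXM momM.
have -> : D (poly_kernel q ^~ y) (poly_kernel p ^~ x) =
    mom (fun i => D (poly_kernel q ^~ y) (iter_kernel i ^~ x)) p by exact: D_mom.
apply: eq_bigr => i _; rewrite densityC.
have -> : D (iter_kernel i ^~ x) (poly_kernel q ^~ y) =
    mom (fun j => D (iter_kernel i ^~ x) (iter_kernel j ^~ y)) q by exact: D_mom.
rewrite mulr_sumr; apply: eq_bigr => j _.
by rewrite mulrA iter_kernelS addnC -kop_iterD.
Qed.

Lemma poly_kernel_bienergy q h : bmeas h ->
  bienergy (poly_kernel q) (D h) (D h) = mom (moment h) ('X * q).
Proof.
move=> bh; have bi i w : bmeas (fun z : borel Omega => iter_kernel i z w).
  exact: bmeas_kop_iter.
have Eh y : D h (fun x => poly_kernel q x y) = mom (fun i => T i.+1 h y) q.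
  rewrite D_mom//; apply: eq_bigr => i _; congr (_ * _).
  by rewrite /iter_kernel kop_iter_sym// /T iterS -/(T i _) [RHS]densityC.
rewrite /bienergy (funext Eh).
rewrite (D_mom (u := fun i => T i.+1 h))//; last by move=> i; exact: bmeas_kop_iter.
by rewrite momXM.
Qed.

(** The energy of a density [h] for this kernel is the value of the moment
    functional of [h] at [X * q]. *)
Lemma psd_poly_kernel q : cone ('X * q) -> psd (poly_kernel q).
Proof.
move=> cq; apply: (psd_of_density cptO full); first exact: ukernel_poly.
by move=> h bh; rewrite poly_kernel_bienergy//; exact: moment_cone_ge0.
Qed.

End kernel_operator.

(** * Limits of kernels in L2, row by row *)

Lemma geometric_steps {R : realType} (a : nat -> R) (c : R) : a 0%N = 0 ->
  (forall i, `|a i.+1 - a i| <= c / 2 ^+ i) ->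
  cvgn a /\ forall i, `|a i| <= 2 * c.
Proof.
move=> a0 ac; have c0 : 0 <= c.
  by have := ac 0%N; rewrite expr0 divr1; apply: le_trans.
split; last first.
  suff H i : `|a i| <= 2 * c - 2 * c / 2 ^+ i.
    by move=> i; rewrite (le_trans (H i))// gerBl divr_ge0 ?mulr_ge0.
  elim: i => [|i ih]; first by rewrite a0 normr0 expr0 divr1 subrr.
  rewrite -(subrK (a i) (a i.+1)) (le_trans (ler_normD _ _))//.
  rewrite (le_trans (lerD (ac i) ih))// exprS invfM mulrA [2 * c / 2]mulrAC.
  by rewrite divff// mul1r; lra.
have -> : a = series (fun i => a i.+1 - a i).
  by apply/funext => i; rewrite /series/= telescope_sumr// a0 subr0.
apply: normed_cvg; apply: (@series_le_cvg _ _ (geometric c 2^-1)) => //.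
- by move=> i /=; exact: normr_ge0.
- by move=> i; rewrite /geometric/= mulr_ge0// exprn_ge0// invr_ge0.
- by move=> i; rewrite /geometric/= exprVn; exact: ac.
- by apply: is_cvg_geometric_series; rewrite gtr0_norm ?invr_gt0// invf_lt1// ltr1n.
Qed.

Section limit_factor.
Context {R : realType} {Omega : pmetricType R}.
Variable mu : probability (borel Omega) R.
Hypothesis cptO : compact [set: Omega].

(** Measurability refers to the product of the Borel sigma-algebras, and not to
    the Borel sets of the product: the kernel is a uniform limit of finite sums of
    products of functions of one variable. *)
Lemma ukernel_measurable_prod (k : Omega -> Omega -> R) : ukernel k ->
  measurable_fun setT (fun w : borel Omega * borel Omega => k w.1 w.2).
Proof.
move=> uk.
have H n : exists k' : Omega -> Omega -> R,
    measurable_fun setT (fun w : borel Omega * borel Omega => k' w.1 w.2) /\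
    forall x y, `|k x y - k' x y| <= n.+1%:R^-1.
  have n0 : 0 < n.+1%:R^-1 / 2 :> R by rewrite divr_gt0// invr_gt0.
  have [del d0 kd] := uk.2 _ n0.
  have [N [p [idx [mA pb]]]] := small_partition cptO d0.
  exists (fun x y => k (p (idx x)) (p (idx y))); split; last first.
    move=> x y; rewrite -(subrKA (k x (p (idx y)))) (le_trans (ler_normD _ _))//.
    rewrite [leRHS]splitr lerD//; first by rewrite !(uk.1 x) distrC kd.
    by rewrite distrC kd.
  rewrite (_ : (fun w => _) = fun w => \sum_(i < N) \sum_(j < N) k (p i) (p j) *
    (\1_(idx @^-1` [set i]) w.1 * \1_(idx @^-1` [set j]) w.2)).
    apply: measurable_sum => i; apply: measurable_sum => j.
    apply: measurable_funM => //; apply: measurable_funM.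
      exact: (measurableT_comp (measurable_indic (mA i)) measurable_fst).
    exact: (measurableT_comp (measurable_indic (mA j)) measurable_snd).
  apply/funext => -[x y] /=; rewrite (bigD1 (idx x))//= (bigD1 (idx y))//=.
  have E0 (u : borel Omega) i : i != idx u -> \1_(idx @^-1` [set i]) u = 0 :> R.
    by move=> /eqP iu; rewrite indicE memNset// => /= /esym.
  have E1 (u : borel Omega) : \1_(idx @^-1` [set idx u]) u = 1 :> R.
    by rewrite indicE mem_set.
  rewrite !E1 !mulr1 !big1 ?addr0// => [i ix|j jy].
    by apply: big1 => j _; rewrite (E0 x)// mul0r mulr0.
  by rewrite (E0 y)// !mulr0.
have [k' Hk'] := choice H.
apply: (@measurable_fun_cvg _ _ _ _
    (fun n (w : borel Omega * borel Omega) => k' n w.1 w.2)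
    (fun w : borel Omega * borel Omega => k w.1 w.2)).
  by move=> n; exact: (Hk' n).1.
move=> [x y] _ /=; apply/cvgrPdist_le => e e0; near=> n.
apply: le_trans ((Hk' n).2 x y) _; apply: ltW; near: n.
exact: (near_infty_natSinv_lt (PosNum e0)).
Unshelve. all: by end_near. Qed.

Variables (a : nat -> Omega -> Omega -> R) (k : Omega -> Omega -> R).
Hypothesis ua : forall i, ukernel (a i).
Hypothesis k_le1 : forall x y, `|k x y| <= 1.
Hypothesis a0 : forall x z, a 0 x z = 0.
(* The L2 distances of successive rows are summable with room for the weights
   [4 ^+ i] in [W]. *)
Hypothesis a_step : forall i x, \int[mu]_z (a i.+1 x z - a i x z) ^+ 2 <= (8 ^+ i)^-1.
Hypothesis a_lim : forall x y, \int[mu]_z (a i x z * a i z y) @[i --> \oo] --> k x y.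

Let d i x (z : borel Omega) := a i.+1 x z - a i x z.

(* Its finiteness at a point gives both the convergence of [a i x z] and the bound
   [a i x z ^+ 2 <= 4 * W x z]. *)
Let W x (z : borel Omega) : \bar R := (\sum_(i <oo) (4 ^+ i * d i x z ^+ 2)%:E)%E.

(** The upper limit is defined everywhere, measurable, and symmetric as the
    [a i] are; its possible infinite values are replaced by zero. *)
Definition limit_kernel (w : borel Omega * borel Omega) : R :=
  fine (limn_esup (fun i => (a i w.1 w.2)%:E)).

Let ba i x : bmeas (fun z : borel Omega => a i x z).
Proof.
rewrite (_ : (fun z => _) = (a i ^~ x)); first exact: ukernel_bmeas (ua i).
by apply/funext => z; rewrite (ua i).1.
Qed.

Let bd i x : bmeas (fun z : borel Omega => 4 ^+ i * d i x z ^+ 2).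
Proof.
have bdi : bmeas (d i x) by exact: bmeasB.
exact: (bmeasZ _ (bmeasM bdi bdi)).
Qed.

Let d0 i x z : (0 <= (4 ^+ i * d i x z ^+ 2)%:E)%E.
Proof. by rewrite lee_fin mulr_ge0 ?sqr_ge0// exprn_ge0. Qed.

Let mW x : measurable_fun setT (W x).
Proof.
apply: ge0_emeasurable_sum => i // _.
by apply/measurable_EFinP; have [] := bd i x.
Qed.

Let W0 x z : (0 <= W x z)%E.
Proof. by apply: nneseries_ge0 => i _ _; exact: d0. Qed.

Lemma dominating_integrable x : mu.-integrable setT (W x).
Proof.
apply/integrableP; split => //.
under eq_integral do rewrite gee0_abs//.
rewrite integral_nneseries//; last first.
  by move=> i; apply/measurable_EFinP; have [] := bd i x.
apply: (@le_lt_trans _ _ (\sum_(i <oo) (2 / (2 ^ i.+1)%:R)%:E)%E); last first.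
  by apply: le_lt_trans (epsilon_trick0 _ _) (ltry 2).
apply: lee_nneseries => i _; first by move=> _; apply: integral_ge0 => z _; exact: d0.
have bdi : bmeas (d i x) by exact: bmeasB.
have int := bmeas_integrable mu (bd i x).
rewrite -[leLHS]fineK; last exact: (integrable_fin_num measurableT int).
rewrite lee_fin.
have -> : fine (\int[mu]_z (4 ^+ i * d i x z ^+ 2)%:E)%E =
    4 ^+ i * \int[mu]_z (d i x z ^+ 2).
  rewrite -RintegralZl//; exact: (bmeas_integrable mu (bmeasM bdi bdi)).
apply: (@le_trans _ _ (4 ^+ i * (8 ^+ i)^-1)).
  by rewrite ler_wpM2l ?exprn_ge0//; exact: a_step.
rewrite natrX exprS invfM mulrA divff// mul1r.
by rewrite (_ : 8 = 4 * 2 :> R) ?exprMn ?invfM ?mulrA ?divff ?mul1r// ?expf_neq0//; ring.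
Qed.

(** Each term [4 ^+ i * d i x z ^+ 2] is at most [W x z], so the increments
    [d i x z] are bounded by the geometric sequence
    [Num.sqrt (fine (W x z)) / 2 ^+ i]. *)
Lemma finite_dominating x z : W x z \is a fin_num ->
  a i x z @[i --> \oo] --> limit_kernel (x, z) /\
  forall i, a i x z ^+ 2 <= 4 * fine (W x z).
Proof.
move=> Wfin; set w := fine (W x z).
have w0 : 0 <= w by apply: fine_ge0.
have dw i : 4 ^+ i * d i x z ^+ 2 <= w.
  rewrite -lee_fin fineK//.
  apply: le_trans (@nneseries_lim_ge R
    (fun i => (4 ^+ i * d i x z ^+ 2)%:E) xpredT 0 i.+1 (fun i _ _ => d0 i x z)).
  by rewrite big_nat_recr//= leeDr//; exact: sume_ge0.
have e4 : 4 = 2 ^+ 2 :> R by rewrite -natrX.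
have step i : `|a i.+1 x z - a i x z| <= Num.sqrt w / 2 ^+ i.
  rewrite -/(d i x z) ler_pdivlMr ?exprn_gt0//.
  rewrite -[leLHS]ger0_norm ?mulr_ge0 ?exprn_ge0// -sqrtr_sqr ler_wsqrtr//.
  apply: le_trans (dw i).
  by rewrite exprMn real_normK ?num_real// mulrC e4 -!exprM mulnC.
have [ca ba2] := geometric_steps (a0 x z) step.
split; last first.
  move=> i; rewrite -(sqr_sqrtr w0) e4.
  by rewrite -exprMn -real_normK ?num_real// lerXn2r// ?nnegrE// mulr_ge0.
have cE : (a i x z)%:E @[i --> \oo] --> (limn (fun i => a i x z))%:E.
  by apply/cvg_EFin; [exact: nearW|exact: ca].
rewrite /limit_kernel /= is_cvg_limn_esupE; last by apply/cvg_ex; eexists; exact: cE.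
by rewrite (cvg_lim _ cE).
Qed.

Lemma limit_kernel_sym x y : limit_kernel (x, y) = limit_kernel (y, x).
Proof.
by rewrite /limit_kernel /=; congr (fine (limn_esup _)); apply/funext => i; rewrite (ua i).1.
Qed.

Lemma measurable_limit_kernel : measurable_fun setT limit_kernel.
Proof.
apply: measurableT_comp; first exact: fine_measurable.
apply: measurable_fun_limn_esup => i; apply/measurable_EFinP.
exact: ukernel_measurable_prod.
Qed.

(** Dominated convergence: [`|a i x z * a i z y|] is bounded by
    [2 * (W x z + W y z)], which is integrable. *)
Lemma limit_kernel_factor x y :
  mu.-integrable setT (fun z => (limit_kernel (x, z) * limit_kernel (z, y))%:E) /\
  k x y = \int[mu]_z (limit_kernel (x, z) * limit_kernel (z, y)).
Proof.
pose f i (z : borel Omega) := (a i x z * a i z y)%:E.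
pose F (z : borel Omega) := (limit_kernel (x, z) * limit_kernel (z, y))%:E.
pose G (z : borel Omega) := (2%:E * (W x z + W y z))%E.
have mf i : measurable_fun setT (f i).
  apply/measurable_EFinP; apply: measurable_funM; first by have [] := ba i x.
  by have [] := ukernel_bmeas cptO y (ua i).
have mF : measurable_fun setT F.
  apply/measurable_EFinP; apply: measurable_funM.
    exact: (measurableT_comp measurable_limit_kernel (measurable_pair1 x)).
  exact: (measurableT_comp measurable_limit_kernel (measurable_pair2 y)).
have iG : mu.-integrable setT G.
  by apply: integrableZl => //; apply: integrableD => //; exact: dominating_integrable.
have fin : {ae mu, forall z, W x z \is a fin_num /\ W y z \is a fin_num}.
  have := integrable_ae measurableT (dominating_integrable x).
  have := integrable_ae measurableT (dominating_integrable y).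
  by apply: filterS2 => z Wy Wx; split; [exact: Wx|exact: Wy].
have fF : {ae mu, forall z, setT z -> f ^~ z @ \oo --> F z}.
  move: fin; apply: filterS => z [Wx Wy] _; apply/cvg_EFin; first exact: nearW.
  rewrite (limit_kernel_sym z y); apply: cvgM; first exact: (finite_dominating Wx).1.
  under eq_fun do rewrite (ua _).1.
  exact: (finite_dominating Wy).1.
have fG : {ae mu, forall z i, setT z -> (`|f i z| <= G z)%E}.
  move: fin; apply: filterS => z [Wx Wy] i _.
  have := (finite_dominating Wx).2 i; have := (finite_dominating Wy).2 i.
  rewrite /G /f [a i z y](ua i).1 -(fineK Wx) -(fineK Wy) /= lee_fin ler_norml.
  have := sqr_ge0 (a i x z + a i y z); have := sqr_ge0 (a i x z - a i y z).
  by move=> *; apply/andP; split; lra.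
have [iF _ lim] := dominated_convergence measurableT mf mF fF iG fG.
split => //.
have lim2 : (\int[mu]_z (a i x z * a i z y))%:E @[i --> \oo] --> (\int[mu]_z F z)%E.
  apply: cvg_trans lim; apply: near_eq_cvg; apply: nearW => i /=.
  rewrite fineK//; apply: (integrable_fin_num measurableT).
  exact: (bmeas_integrable mu (bmeasM (ba i x) (ukernel_bmeas cptO y (ua i)))).
have lim3 : (\int[mu]_z (a i x z * a i z y))%:E @[i --> \oo] --> (k x y)%:E.
  by apply/cvg_EFin; [exact: nearW|exact: a_lim].
by rewrite /Rintegral -(cvg_lim _ lim2)// (cvg_lim _ lim3).
Qed.

(** By Tonelli the integral of the square is the integral of the diagonal of
    [k]. *)
Lemma limit_kernel_Lfun2 : limit_kernel \in Lfun (mu \x mu)%E 2%:E.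
Proof.
have mk := measurable_limit_kernel.
rewrite inE; apply/andP; split; rewrite inE//=.
rewrite /finite_norm unlock; apply: poweR_lty.
have msq : measurable_fun setT (fun w => (limit_kernel w ^+ 2)%:E).
  by apply/measurable_EFinP; exact: measurable_funX.
rewrite (eq_integral (fun w => (limit_kernel w ^+ 2)%:E)); last first.
  by move=> w _ /=; rewrite powR_mulrn// real_normK// num_real.
rewrite fubini_tonelli1//; last by move=> w; rewrite lee_fin sqr_ge0.
apply: (@le_lt_trans _ _ (\int[mu]_x (cst 1%E : borel Omega -> \bar R) x)%E); last first.
  by rewrite integral_cst//= mul1e probability_setT ltry.
have F0 (w : borel Omega * borel Omega) : (0 <= (limit_kernel w ^+ 2)%:E)%E.
  by rewrite lee_fin sqr_ge0.
apply: ge0_le_integral => //.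
- by move=> x _; apply: integral_ge0.
- exact: measurable_fun_fubini_tonelli_F.
move=> x _; have [iF kE] := limit_kernel_factor x x; rewrite /fubini_F /cst.
rewrite (eq_integral (fun z => (limit_kernel (x, z) * limit_kernel (z, x))%:E)).
  rewrite -[leLHS]fineK; last exact: (integrable_fin_num measurableT iF).
  by rewrite lee_fin -/(Rintegral _ _ _) -kE (le_trans (ler_norm _)).
by move=> z _; rewrite expr2 {2}limit_kernel_sym.
Qed.

Lemma limit_kernel_factorization :
  symmetric_L2_factorization mu (fun w => k w.1 w.2).
Proof.
exists limit_kernel; split; first exact: limit_kernel_Lfun2.
- exact: limit_kernel_sym.
- by move=> x y; have [] := limit_kernel_factor x y.
- by move=> x y; have [] := limit_kernel_factor x y.
Qed.

End limit_factor.

Lemma symmetric_L2_factorizationZ {R : realType} {Omega : pmetricType R}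
    (mu : probability (borel Omega) R) (K : Omega * Omega -> R) (c : R) : 0 <= c ->
  symmetric_L2_factorization mu K ->
  symmetric_L2_factorization mu (fun w => c * K w).
Proof.
move=> c0 [k [Lk sk ik Kk]].
have cE x y z : c * (k (x, z) * k (z, y)) =
    Num.sqrt c * k (x, z) * (Num.sqrt c * k (z, y)).
  by rewrite mulrACA -expr2 sqr_sqrtr.
exists (fun w => Num.sqrt c * k w); split=> [|x y|x y|x y].
- rewrite (_ : (fun w => _) = Num.sqrt c \o* k); first by apply: Lfun_scale; rewrite ?ler1n.
  by apply/funext => w /=; rewrite mulrC.
- by rewrite sk.
- under eq_fun do rewrite -cE EFinM.
  exact: (integrableZl measurableT _ (ik x y)).
- rewrite Kk -RintegralZl//; last exact: ik.
  by apply: eq_Rintegral => z _; rewrite cE.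
Qed.

(** * Square root of a positive semidefinite kernel *)

Section square_root.
Context {R : realType} {Omega : pmetricType R}.
Variables (mu : probability (borel Omega) R) (k : Omega -> Omega -> R).
Hypothesis cptO : compact [set: Omega].
Hypothesis full : measure_support mu = [set: Omega].
Hypothesis uk : ukernel k.
Hypothesis pk : psd k.
Hypothesis k_le1 : forall x y, `|k x y| <= 1.

Let s := @sqrt_quot R.
Let E := poly_kernel mu k.
Let a n := E (s n).
Let r n := E (1 - 'X * s n ^+ 2).

Let uE q : ukernel (E q). Proof. exact: ukernel_poly. Qed.

Lemma residual_kernelE n x y :
  r n x y = k x y - \int[mu]_z (a n x z * a n z y).
Proof. by rewrite /r /E poly_kernelB poly_kernel1 poly_kernelM// -expr2. Qed.

Let pr n : psd (r n).
Proof. by apply: psd_poly_kernel => //; exact: cone_residualE. Qed.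

Let sr n : symk (r n). Proof. exact: (uE _).1. Qed.

Lemma residual_kernel_kdist n x y : kdist (r n) x y <= kdist k x y.
Proof.
have p2 : psd (E ('X * s n ^+ 2)) by apply: psd_poly_kernel => //; exact: cone_square_le.
have := kdist_ge0 p2 (uE _).1 x y; rewrite /kdist /r /E !poly_kernelB !poly_kernel1; lra.
Qed.

Lemma residual_kernel0 x y : r 0 x y = k x y.
Proof. by rewrite /r /E /s /= expr0n mulr0 subr0 poly_kernel1. Qed.

(** The left side is the diagonal of the kernel of [(y_n - y_m) (T) ^+ 2], and the
    polynomial [(y_n - y_m) ^+ 2] is at most the residual [X - y_m ^+ 2]. *)
Lemma sqrt_kernel_step m n x : (m <= n)%N ->
  \int[mu]_z (a n x z - a m x z) ^+ 2 <= r m x x.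
Proof.
move=> mn; have pc : psd (E (1 - 'X * s m ^+ 2 - 'X * (s n - s m) ^+ 2)).
  by apply: psd_poly_kernel => //; exact: cone_sqrt_cauchy.
have := psd_diag pc x; rewrite /E poly_kernelB -/(r m) subr_ge0; apply: le_trans.
rewrite expr2 -poly_kernelM// le_eqVlt; apply/orP; left; apply/eqP.
apply: eq_Rintegral => z _; rewrite expr2 !poly_kernelB; congr (_ * _).
by rewrite /a (uE (s n)).1 (uE (s m)).1.
Qed.

Lemma residual_kernel_rate n h : bmeas h ->
  n%:R * bienergy (r n) (density mu h) (density mu h) <= 2 * density mu h h.
Proof.
move=> bh; have := moment_cone_ge0 mu cptO uk pk k_le1 bh (cone_residual_rate n).
have -> : 2%:R - n%:R * ('X * (1 - 'X * s n ^+ 2)) =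
    (2 : R) *: 1 - (n%:R : R) *: ('X * (1 - 'X * s n ^+ 2)).
  by rewrite -!mul_polyC !polyC_natr mulr1.
rewrite momB !momZ mom1 subr_ge0 => H.
by rewrite /r /E poly_kernel_bienergy.
Qed.

(** With vectors [x], [y = x + u] and [z = x + v] the difference of the two sides is
    [`|x / 2 + u| ^+ 2 + `|x / 2 + v| ^+ 2 + `|u + v| ^+ 2 / 2]. *)
Lemma psd_diag_le_near (c : Omega -> Omega -> R) x y z : psd c -> symk c ->
  c x x / 2 <= c y z + 3 / 2 * (kdist c x y + kdist c x z).
Proof.
move=> pc sc; have := psd2 pc sc 1 (- (1 / 2)) y x; have := psd2 pc sc 1 (- (1 / 2)) z x.
have := pc [:: (1, y); (1, z); (-2, x)]; rewrite !big_cons !big_nil /= /kdist.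
by rewrite (sc z y) (sc y x) (sc z x); lra.
Qed.

Let kdist_small (e del : R) :
  (forall x y, ball x del y -> forall z, `|k x z - k y z| <= e) ->
  forall x y, ball x del y -> kdist k x y <= 2 * e.
Proof.
move=> H x y xy; have := H x y xy x; have := H x y xy y.
rewrite /kdist (uk.1 y x) !ler_norml => /andP[? ?] /andP[? ?]; lra.
Qed.

(** Near [x] the residual kernel is at least about half its value at [(x, x)], so
    the form of [r n] at the average over a small ball is bounded below by this
    value; and this form is [O(1 / n)] by [residual_kernel_rate]. *)
Lemma residual_kernel_point x (e : R) : 0 < e ->
  exists N, forall n, (N <= n)%N -> r n x x <= e.
Proof.
move=> e0; have e1 : 0 < e / 24 by rewrite divr_gt0.
have [del d0 /kdist_small H] := uk.2 _ e1.
pose B : set (borel Omega) := (ball x del)°.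
have mB : measurable B by apply: open_measurable_borel; exact: open_interior.
have B0 : (0 < mu B)%E by exact: ball_gt0.
pose h := avg_density mu B; have bh : bmeas h by exact: bmeas_avg_density.
have Dh0 : 0 <= density mu h h by apply: Rintegral_ge0 => z _; exact: sqr_ge0.
have [N HN] : exists N : nat, 8 * density mu h h / e < N%:R.
  exists (Num.bound (8 * density mu h h / e)); apply: archi_boundP.
  by rewrite divr_ge0 ?mulr_ge0// ltW.
exists N => n Nn.
have n0 : 0 < n%:R :> R.
  rewrite (lt_le_trans _ (_ : N%:R <= n%:R))// ?ler_nat//.
  by apply: le_lt_trans HN; rewrite divr_ge0 ?mulr_ge0// ltW.
have up : bienergy (r n) (density mu h) (density mu h) <= e / 4.
  rewrite -(ler_pM2l n0) (le_trans (residual_kernel_rate n bh))//.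
  have : 8 * density mu h h <= e * n%:R.
    by rewrite -ler_pdivrMl// mulrC (le_trans (ltW HN))// ler_nat.
  lra.
have [C bD] := bfunctional_density mu bh.
have lo : r n x x / 2 - e / 4 <= bienergy (r n) (density mu h) (density mu h).
  apply: avg_density_ge => //.
    by apply: ucont_bmeas => //; exact: (potential_ucont cptO (uE _) bD).
  move=> z /interior_subset xz; apply: avg_density_ge => //.
    exact: (ukernel_bmeas cptO _ (uE _)).
  move=> y /interior_subset xy; have := psd_diag_le_near x y z (pr n) (sr n).
  have := residual_kernel_kdist n x y; have := residual_kernel_kdist n x z.
  have := H _ _ xy; have := H _ _ xz; lra.
lra.
Qed.

(** Equicontinuity in the sense of [residual_kernel_kdist] reduces uniform
    convergence to convergence at finitely many centres. *)
Lemma residual_kernel_cvg0 (e : R) : 0 < e ->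
  exists N, forall n, (N <= n)%N -> forall x, r n x x <= e.
Proof.
move=> e0; have e1 : 0 < e / 8 by rewrite divr_gt0.
have [del d0 /kdist_small H] := uk.2 _ e1.
have [m [p [idx [_ pb]]]] := small_partition cptO d0.
have e2 : 0 < e / 4 by rewrite divr_gt0.
have [N HN] := choice (fun i => residual_kernel_point (p i) e2).
exists (\sum_i N i)%N => n Nn x.
have Ni : (N (idx x) <= n)%N by rewrite (leq_trans _ Nn)// (bigD1 (idx x))//= leq_addr.
have := HN _ _ Ni; have := H _ _ (pb x).
have := residual_kernel_kdist n (p (idx x)) x.
have := psd2 (pr n) (sr n) 1 (-2) x (p (idx x)).
by rewrite /kdist (sr n (p _) x); lra.
Qed.

Lemma psd_factorization : symmetric_L2_factorization mu (fun w => k w.1 w.2).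
Proof.
have H i : exists N, forall n, (N <= n)%N -> forall x, r n x x <= (8 ^+ i)^-1.
  by apply: residual_kernel_cvg0; rewrite invr_gt0 exprn_gt0.
have [N HN] := choice H.
(* The subsequence starts at [0], where the approximate square root is zero; the
   bound for [i = 0] holds because the diagonal of [k] is at most [1]. *)
pose sub i := (\sum_(j < i) N j.+1)%N.
have subS i : (sub i <= sub i.+1)%N by rewrite /sub big_ord_recr leq_addr.
have sub_r i x : r (sub i) x x <= (8 ^+ i)^-1.
  case: i => [|i]; last by apply: HN; rewrite /sub big_ord_recr leq_addl.
  rewrite /sub big_ord0 residual_kernel0 expr0 invr1.
  by rewrite (le_trans (ler_norm _)).
have r_le i x y : `|r (sub i) x y| <= (8 ^+ i)^-1 by apply: psd_le_max.
apply: (@limit_kernel_factorization _ _ mu cptO (fun i => a (sub i))) => //.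
- by move=> i; exact: uE.
- by move=> x z; rewrite /sub big_ord0 /a /E /s /= /poly_kernel mom0.
- by move=> i x; apply: le_trans (sub_r i x); exact: sqrt_kernel_step.
move=> x y; rewrite (_ : (fun i => _) = (fun i => k x y - r (sub i) x y)); last first.
  by apply/funext => i; rewrite residual_kernelE opprB addrC subrK.
rewrite -[X in _ --> X]subr0; apply: cvgB; first exact: cvg_cst.
apply/norm_cvg0P.
apply: (@squeeze_cvgr _ _ _ _ (fun=> 0) (fun i => (8^-1) ^+ i)).
- by apply: nearW => i; rewrite normr_ge0/= exprVn r_le.
- exact: cvg_cst.
- by apply: cvg_expr; rewrite gtr0_norm ?invr_gt0// invf_lt1// ltr1n.
Qed.

End square_root.

(** Scaling by the maximum of the diagonal, which bounds the kernel, reduces to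
    kernels bounded by [1]. *)
Lemma psd_symmetric_L2_factorization {R : realType} {Omega : pmetricType R}
    (mu : probability (borel Omega) R) (K : Omega * Omega -> R) :
  compact [set: Omega] -> measure_support mu = [set: Omega] ->
  ukernel (fun x y => K (x, y)) -> psd (fun x y => K (x, y)) ->
  symmetric_L2_factorization mu K.
Proof.
move=> cptO full uk pk; have [p pmax] := ukernel_max cptO uk.
set k := fun x y => K (x, y) in uk pk pmax.
have M0 : 0 <= k p p by exact: psd_diag.
have M1 : 0 < k p p + 1 by rewrite ltr_wpDl.
pose k1 x y := (k p p + 1)^-1 * k x y.
have uk1 : ukernel k1.
  split; first by move=> x y; rewrite /k1 uk.1.
  move=> e e0; have [del d0 H] := uk.2 _ (mulr_gt0 M1 e0).
  exists del => // x y xy z; rewrite /k1 -mulrBr normrM gtr0_norm ?invr_gt0//.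
  by rewrite ler_pdivrMl// H.
have pk1 : psd k1.
  move=> s; rewrite (_ : \sum_(v <- s) _ = (k p p + 1)^-1 *
      \sum_(v <- s) \sum_(w <- s) v.1 * w.1 * k v.2 w.2).
    by rewrite mulr_ge0// invr_ge0 ltW.
  rewrite mulr_sumr; apply: eq_bigr => v _; rewrite mulr_sumr.
  by apply: eq_bigr => w _; rewrite /k1; ring.
have k1_le x y : `|k1 x y| <= 1.
  rewrite normrM gtr0_norm ?invr_gt0// ler_pdivrMl// mulr1.
  rewrite (@le_trans _ _ (k p p)) ?lerDl//.
  exact: (psd_le_max pk uk.1 (pmax x) (pmax y)).
have := psd_factorization cptO full uk1 pk1 k1_le.
move=> /(symmetric_L2_factorizationZ (ltW M1)).
rewrite (_ : (fun w => _) = K)//; apply/funext => -[x y].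
by rewrite /k1 mulrA divff ?mul1r// gt_eqF.
Qed.

(** * Equivalence of the six conditions *)

Theorem theorem4p2 (R : realType) (Omega : pmetricType R)
    (K : Omega * Omega -> R) (mu : probability (borel Omega) R) :
  compact [set: Omega] ->
  kernel_function K ->
  invariant_measure K (charge_of_probability mu) ->
  measure_support mu = [set: Omega] ->
  [<-> positive_definite K;
       forall mu1 mu2 : probability (borel Omega) R,
         0 <= energy K (charge_of_probability mu1) /\
         mutual_energy K (charge_of_probability mu1) (charge_of_probability mu2)
           <= Num.sqrt (energy K (charge_of_probability mu1) *
                        energy K (charge_of_probability mu2));
       (forall nu : probability (borel Omega) R,
          energy K (charge_of_probability mu)
            <= energy K (charge_of_probability nu)) /\
       0 <= energy K (charge_of_probability mu);
       energy_convex K;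
       mercer_expansion mu K;
       symmetric_L2_factorization mu K].
Proof.
move=> cptO kK inv full; have uk := kernel_function_ukernel cptO kK.
tfae.
- move=> /(positive_definite_psd cptO uk) pk mu1 mu2.
  by split; [exact: psd_energy_ge0|exact: psd_cauchy_schwarz].
(* As the potential of [mu] is constant, its mutual energy with any probability
   [nu] is the energy of [mu]. *)
- move=> CS; have [I0 _] := CS mu mu; split => // nu.
  have [_] := CS mu nu; have [J0 _] := CS nu nu.
  have -> : mutual_energy K (charge_of_probability mu) (charge_of_probability nu) =
      energy K (charge_of_probability mu).
    rewrite /mutual_energy (_ : (fun y => _) =
        fun=> energy K (charge_of_probability mu)); last first.
      apply/funext => y; rewrite -(inv y); congr charge_integral.
      by apply/funext => x; exact: uk.1.
    rewrite charge_of_probabilityE//; last first.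
      by move=> e e0; exists 1 => // x y _; rewrite subrr normr0 ltW.
    by rewrite Rintegral_cst// [X in fine X]probability_setT mulr1.
  move: I0 J0; set I := energy _ _; set J := energy _ _ => I0 J0 IJ.
  have [//|JI] := leP I J.
  have I1 : 0 < I by exact: le_lt_trans JI.
  have : I ^+ 2 <= I * J.
    by rewrite -(sqr_sqrtr (mulr_ge0 I0 J0)) lerXn2r ?nnegrE ?sqrtr_ge0.
  by rewrite expr2 ler_pM2l// leNgt JI.
- move=> [minmu I0]; apply: psd_energy_convex => //.
  apply: (psd_of_density cptO full uk) => h bh.
  exact: minimizer_density.
- move=> /(energy_convex_psd cptO uk) pk.
  exact: (psd_mercer cptO uk pk full).
- move=> /mercer_expansion_psd pk; exact: psd_symmetric_L2_factorization.
- by move=> /factorization_psd pk; apply/positive_definite_psd.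
Qed.
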